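(* Consider a two-color balanced affine tenable large-index urn model ($a_m\neq0$, $\frac12<\Lambda<1$) with sample size $m\ge1$, under either sampling model $\mathcal M$ or $\mathcal R$. With coefficients $f_{n,s,r}$ and $\varphi_{n,s,k}$ as defined in the context, the positive integer moments $\mathbb E[\tilde W_n^s]$ of the shifted random variable $\tilde W_n=W_n-\frac{n a_m}{1-\Lambda}$ are given by $$\mathbb E[\tilde W_n^s]=\sum_{k=0}^{s}\varphi_{n,s,k}W_0^k.$$ The limits $E_s=\lim_{n\to\infty}\mathbb E\big[(\tilde W_n/n^{\Lambda})^s\big]$ can be expressed as $$E_s=\begin{cases}\displaystyle\bigg(\prod_{\ell=1}^{s^*}\frac{\Gamma(\frac{T_0+1-\ell}{\sigma})}{\Gamma(\lambda_{\ell,s})}\bigg)\sum_{k=0}^{s}\tilde\varphi_{s,k}W_0^k,&\text{model }\mathcal M,\\[3mm]\displaystyle\frac{\Gamma(\frac{T_0}{\sigma})^s}{\prod_{\ell=1}^{s}\Gamma(\mu_{\ell,s})}\sum_{k=0}^{s}\tilde\varphi_{s,k}W_0^k,&\text{model }\mathcal R.\end{cases}$$ Here, for $1\le k\le s$, $\tilde\varphi_{s,k}=\lim_{n\to\infty}\varphi_{n,s,k}/\varphi_{n,s,s}$; in particular $\tilde\varphi_{s,s}=1$, and for $1\le k\le s-1$ the values $\tilde\varphi_{s,k}$ are convergent infinite sums: $$\tilde\varphi_{s,k}=\sum_{\ell=1}^{s-k}\ \sum_{\substack{h_1+\dots+h_\ell=s-k\\ h_\nu\ge1}}\bigg[\sum_{1\le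 i_\ell<\dots<i_1<\infty}f_{i_1,s,s-H_1}\,\frac{\prod_{g=2}^{\ell+1}\Big(f_{i_g,s-H_{g-1},s-H_g}\prod_{j=i_g+1}^{i_{g-1}-1}f_{j,s-H_{g-1},s-H_{g-1}}\Big)}{\prod_{j=1}^{i_1}f_{j,s,s}}\bigg]$$ with $H_q=\sum_{\nu=1}^{q}h_\nu$, $i_{\ell+1}=0$, and a factor $f_{0,\cdot,\cdot}$ (occurring for $g=\ell+1$) read as $1$. Moreover, $\tilde\varphi_{s,0}$ is a convergent infinite sum: $$\tilde\varphi_{s,0}=\sum_{k=1}^{\infty}\sum_{\ell=1}^{s}\sum_{r=1}^{s-\ell}\ \sum_{\substack{h_1+\dots+h_r=s-\ell\\ h_\nu\ge1}}\bigg[\sum_{k+1\le i_r<\dots<i_1<\infty}\frac{\prod_{g=2}^{r+1}\Big(f_{i_g,s-H_{g-1},s-H_g}\prod_{j=i_g+1}^{i_{g-1}-1}f_{j,s-H_{g-1},s-H_{g-1}}\Big)}{\prod_{j=1}^{i_1}f_{j,s,s}}\bigg]$$ with $H_q=\sum_{\nu=1}^{q}h_\nu$ for $1\le q\le r$, $i_{r+1}=k$, $H_{r+1}=s$.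
   Context: Urn model. Fix integers $m\ge1$ and $\sigma\ge1$. An urn contains white and black balls; $W_n$ and $B_n$ denote their numbers after $n$ draws ($W_0,B_0$ nonrandom), and $T_n=W_n+B_n$. At each step a sample of $m$ balls is drawn, its colors are observed, and the sample is returned to the urn; if the sample has $k$ white and $m-k$ black balls, then $a_{m-k}$ white and $b_{m-k}$ black balls are added (negative numbers mean removal), $0\le k\le m$, where $a_k,b_k$ are integers. Standing assumptions: balanced, $a_k+b_k=\sigma$ for all $0\le k\le m$, so $T_n=T_0+\sigma n$; affine, $a_k=(m-k)(a_{m-1}-a_m)+a_m$ for $0\le k\le m$; tenable, i.e. the process can be continued forever (in particular $W_n,B_n\ge0$ always; for model $\mathcal M$ one has $a_k\ge-(m-k)$ for $0\le k\le m$; for model $\mathcal R$ one has $a_k\ge -1$ for $0\le k\le m-1$ and $a_m\ge0$); and $T_0\ge m$. Sampling. Given the first $n-1$ draws, the probability that the $n$th sample has exactly $k$ white balls is $\binom{W_{n-1}}{k}\binom{B_{n-1}}{m-k}/\binom{T_{n-1}}{m}$ in model $\mathcal M$ (without replacement) and $\binom mk W_{n-1}^kB_{n-1}^{m-k}/T_{n-1}^m$ in model $\mathcal R$ (with replacement). Notation: $\Lambda=\frac m\sigma(a_{m-1}-a_m)$, $C=\frac{\Lambda\sigma}{m}$, $s^*=\min\{s,m\}$, $0^0=1$. ${s\brace k}$ are the Stirling numbers of the second kind, ${s\brack k}$ the unsigned Stirling numbers of the first kind, $x^{\underline{k}}=x(x-1)\cdots(x-k+1)$. Coefficients $f$. For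 $n\ge1$ and $0\le r\le s$, $$f_{n,s,r}=\sum_{j=s-r}^{s}\binom sj\Lambda^j\sum_{\ell=j-(s-r)}^{j}\binom{\ell}{j-(s-r)}\Big(\frac{a_m(n-1)}{1-\Lambda}\Big)^{\ell-j+s-r}\sum_{i=\ell}^{j}\binom ji\frac{\sigma^ia_m^{j-i}}{m^i(\Lambda-1)^{j-i}}\,p_{n;(i,\ell)},$$ where, with $i^*=\min\{i,m\}$, $p_{n;(i,\ell)}=\sum_{h=\ell}^{i^*}(-1)^{h-\ell}{h\brack \ell}{i\brace h}\binom mh/\binom{T_{n-1}}{h}$ for model $\mathcal M$ and $p_{n;(i,\ell)}={i\brace\ell}\,m^{\underline{\ell}}/T_{n-1}^{\ell}$ for model $\mathcal R$. Coefficients $\varphi$. $\varphi_{n,s,s}=\prod_{j=1}^nf_{j,s,s}$. For $1\le k\le s-1$, $$\varphi_{n,s,k}=\sum_{\ell=1}^{s-k}\ \sum_{\substack{h_1+\dots+h_\ell=s-k\\ h_\nu\ge1}}\bigg[\sum_{1\le i_\ell<\dots<i_1\le n}\prod_{g=1}^{\ell+1}\Big(f_{i_g,s-H_{g-1},s-H_g}\prod_{j=i_g+1}^{i_{g-1}-1}f_{j,s-H_{g-1},s-H_{g-1}}\Big)\bigg],$$ with $H_q=\sum_{\nu=1}^qh_\nu$, $H_0=0$, $i_0=n+1$, $i_{\ell+1}=0$, and $f_{0,\cdot,\cdot}$ read as $1$. For $k=0$, $$\varphi_{n,s,0}=\sum_{k=1}^{n}\sum_{\ell=1}^{s}\sum_{r=1}^{s-\ell}\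 \sum_{\substack{h_1+\dots+h_r=s-\ell\\ h_\nu\ge1}}\bigg[\sum_{k+1\le i_r<\dots<i_1\le n}\prod_{g=1}^{r+1}\Big(f_{i_g,s-H_{g-1},s-H_g}\prod_{j=i_g+1}^{i_{g-1}-1}f_{j,s-H_{g-1},s-H_{g-1}}\Big)\bigg],$$ with $H_q=\sum_{\nu=1}^qh_\nu$ for $0\le q\le r$, $i_0=n+1$, $i_{r+1}=k$, $H_{r+1}=s$. Roots. $\lambda_{1,s},\dots,\lambda_{s^*,s}$ are the negated complex roots (with multiplicity) of the monic polynomial $P_s(x)=\frac{s^*!}{\sigma^{s^*}}\sum_{\ell=0}^{s^*}\frac{\binom s\ell}{\binom{s^*}\ell}C^\ell\binom m\ell\binom{x\sigma+T_0-\ell}{s^*-\ell}=\prod_{\ell=1}^{s^*}(x+\lambda_{\ell,s})$. $\mu_{1,s},\dots,\mu_{s,s}$ are the negated complex roots (with multiplicity) of the monic polynomial $Q_s(x)=\frac1{\sigma^s}\sum_{\ell=0}^s\binom s\ell C^\ell\binom m\ell\ell!\,(x\sigma+T_0)^{s-\ell}=\prod_{\ell=1}^{s}(x+\mu_{\ell,s})$.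
   Formalization: In φ_{n,s,0} and φ̃_{s,0} the sum over r starts at 0 instead of 1 (adding the direct jump from level s to 0), and the factor f_{i_1,s,s-H_1} missing from the printed summand of φ̃_{s,0} is included; the printed formulas already fail for s=1. *)

(* Defs.v *)
(* MathComp world, with MathComp-Analysis and real-closed (R[i]). *)
From HB Require Import structures.
From mathcomp Require Import all_boot all_order all_algebra.
From mathcomp Require Import complex.
From mathcomp Require Import all_classical all_reals all_analysis.

Set Implicit Arguments.
Unset Strict Implicit.
Unset Printing Implicit Defensive.

Import Order.TTheory GRing.Theory Num.Theory.
Import numFieldNormedType.Exports.

Local Open Scope classical_set_scope.
Local Open Scope ring_scope.

Inductive sampling := without_replacement | with_replacement.

Record urn := Urn {
  model : sampling;
  ssize : nat;          (* m *)
  sigma : nat;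
  addw : nat -> int;    (* a_k, only used for k <= m *)
  addb : nat -> int;    (* b_k, only used for k <= m *)
  white0 : nat;         (* W_0 *)
  black0 : nat          (* B_0 *)
}.

Definition total_balls (u : urn) (n : nat) : nat :=
  (white0 u + black0 u + sigma u * n)%N.

Definition balanced (u : urn) : Prop :=
  forall k, (k <= ssize u)%N -> addw u k + addb u k = (sigma u)%:Z.

Definition affine (u : urn) : Prop :=
  let m := ssize u in
  forall k, (k <= m)%N ->
    addw u k = (m - k)%N%:Z * (addw u m.-1 - addw u m) + addw u m.

(* [draw_weight u w b k / draw_weights u (w + b)] is the probability of exactly
   k white balls in a sample of size m from w white and b black balls. *)
Definition draw_weight (u : urn) (w b k : nat) : nat :=
  match model u with
  | without_replacement => ('C(w, k) * 'C(b, ssize u - k))%N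
  | with_replacement => ('C(ssize u, k) * w ^ k * b ^ (ssize u - k))%N
  end.

Definition draw_weights (u : urn) (t : nat) : nat :=
  match model u with
  | without_replacement => 'C(t, ssize u)
  | with_replacement => (t ^ ssize u)%N
  end.

(* Contents are integers, since removals are allowed; in a tenable urn every
   reachable content is nonnegative, so that the absolute values are harmless. *)
Inductive reachable (u : urn) : int -> int -> Prop :=
| reachable0 : reachable u (white0 u)%:Z (black0 u)%:Z
| reachableS w b k : reachable u w b -> (k <= ssize u)%N ->
    (0 < draw_weight u `|w|%N `|b|%N k)%N ->
    reachable u (w + addw u (ssize u - k)) (b + addb u (ssize u - k)).

Definition tenable (u : urn) : Prop :=
  (forall w b, reachable u w b -> 0 <= w /\ 0 <= b) /\
  match model u with
  | without_replacement =>
      forall k, (k <= ssize u)%N -> - (ssize u - k)%N%:Z <= addw u k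
  | with_replacement =>
      (forall k, (k < ssize u)%N -> -1 <= addw u k) /\ 0 <= addw u (ssize u)
  end.

(* Contents after n draws, when the (i+1)-th sample has [h i] white balls. *)
Definition white (u : urn) (h : nat -> nat) (n : nat) : int :=
  (white0 u)%:Z + \sum_(i < n) addw u (ssize u - h i).
Definition black (u : urn) (h : nat -> nat) (n : nat) : int :=
  (black0 u)%:Z + \sum_(i < n) addb u (ssize u - h i).

Definition draw_prob (R : realType) (u : urn) (w b : int) (k : nat) : R :=
  (draw_weight u `|w|%N `|b|%N k)%:R / (draw_weights u (`|w| + `|b|)%N)%:R.

(* [K i] is the number of white balls in the (i+1)-th sample: its conditional
   law given that K_0, ..., K_{n-1} equal h 0, ..., h (n-1) is [draw_prob]. *)
Definition urn_process (R : realType) (u : urn) (d : measure_display)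
    (Omega : measurableType d) (P : probability Omega R)
    (K : nat -> {RV P >-> nat}) : Prop :=
  forall (n : nat) (h : nat -> nat), (h n <= ssize u)%N ->
    (P [set w | forall i, (i < n.+1)%N -> K i w = h i] =
     P [set w | forall i, (i < n)%N -> K i w = h i] *
     (draw_prob R u (white u h n) (black u h n) (h n))%:E)%E.

Fixpoint stirling2 (n k : nat) : nat :=
  match n, k with
  | 0, 0 => 1
  | 0, _.+1 => 0
  | _.+1, 0 => 0
  | n'.+1, k'.+1 => k * stirling2 n' k + stirling2 n' k'
  end%N.

Fixpoint stirling1 (n k : nat) : nat :=
  match n, k with
  | 0, 0 => 1
  | 0, _.+1 => 0
  | _.+1, 0 => 0
  | n'.+1, k'.+1 => n' * stirling1 n' k + stirling1 n' k'
  end%N.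

Section coefficients.
Variables (R : realType) (u : urn).

Local Notation m := (ssize u).
Local Notation a_m := ((addw u (ssize u))%:~R : R).

Definition Lambda : R :=
  m%:R / (sigma u)%:R * (addw u m.-1 - addw u m)%:~R.

Definition Cst : R := Lambda * (sigma u)%:R / m%:R.

Definition shifted (n : nat) (w : int) : R :=
  w%:~R - n%:R * a_m / (1 - Lambda).

(* [pcoef n' i l] is p_{n;(i,l)} for n = n'+1. *)
Definition pcoef (n' i l : nat) : R :=
  match model u with
  | without_replacement =>
      \sum_(l <= h < (minn i m).+1)
        (-1) ^+ (h - l) * (stirling1 h l)%:R * (stirling2 i h)%:R
        * ('C(m, h)%:R / 'C(total_balls u n', h)%:R)
  | with_replacement =>
      (stirling2 i l)%:R * (m ^_ l)%:R / (total_balls u n')%:R ^+ l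
  end.

(* Reading f_{0,s,r} as 1 covers the last factor of the chain products. *)
Definition fcoef (n s r : nat) : R :=
  if n is n'.+1 then
    \sum_(s - r <= j < s.+1) 'C(s, j)%:R * Lambda ^+ j *
      \sum_(j - (s - r) <= l < j.+1) 'C(l, j - (s - r))%:R
        * (a_m * n'%:R / (1 - Lambda)) ^+ (l - (j - (s - r))) *
        \sum_(l <= i < j.+1) 'C(j, i)%:R
          * ((sigma u)%:R ^+ i * a_m ^+ (j - i)
             / (m%:R ^+ i * (Lambda - 1) ^+ (j - i)))
          * pcoef n' i l
  else 1.

(* s - H_q, where H_q = h_1 + ... + h_q *)
Definition level (s : nat) (h : seq nat) (q : nat) : nat := s - sumn (take q h).

Definition chain_factor (s : nat) (h : seq nat) (I : nat -> nat) (g : nat) : R :=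
  fcoef (I g) (level s h g.-1) (level s h g) *
  \prod_((I g).+1 <= j < I g.-1) fcoef j (level s h g.-1) (level s h g.-1).

(* The chain i_1 > ... > i_r is the sequence [i]; i_0 = n+1, i_{r+1} = [last]. *)
Definition phi_term (n s : nat) (h i : seq nat) (last : nat) : R :=
  let I := nth 0%N (n.+1 :: rcons i last) in
  \prod_(1 <= g < (size i).+2) chain_factor s h I g.

(* [phi_term] divided by f_{1,s,s} ... f_{n,s,s}: the factors of index larger
   than i_1 cancel, and i_0 becomes irrelevant. *)
Definition tphi_term (s : nat) (h i : seq nat) (last : nat) : R :=
  let I := nth 0%N (0%N :: rcons i last) in
  fcoef (I 1%N) s (level s h 1) *
  ((\prod_(2 <= g < (size i).+2) chain_factor s h I g)
   / \prod_(1 <= j < (I 1%N).+1) fcoef j s s).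

End coefficients.

Definition composition (l t : nat) (h : seq nat) : bool :=
  [&& size h == l, all (leq 1) h & sumn h == t].

(* Sum of [F h] over the compositions h of t into l positive parts. *)
Definition comp_sum (R : realType) (l t : nat) (F : seq nat -> R) : R :=
  \sum_(h : l.-tuple 'I_t.+1 | composition l t [seq val x | x <- h])
    F [seq val x | x <- h].

(* Sum of [F [:: i_1; ...; i_l]] over lo <= i_l < ... < i_1 <= n. *)
Definition chain_sum (R : realType) (lo n l : nat) (F : seq nat -> R) : R :=
  \sum_(i : l.-tuple 'I_n.+1 | sorted gtn [seq val x | x <- i] &&
                               all (leq lo) [seq val x | x <- i])
    F [seq val x | x <- i].

(* Infinite sums over lo <= i_l < ... < i_1 < oo: absolute summability, and the
   value as limit of the sums truncated at i_1 <= N. *)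
Definition chain_summable (R : realType) (lo l : nat) (F : seq nat -> R) : Prop :=
  cvgn (fun N => chain_sum lo N l (fun i => `|F i|)).

Definition chain_series (R : realType) (lo l : nat) (F : seq nat -> R) : R :=
  limn (fun N => chain_sum lo N l F).

(* For k = 0, the chain i_1 > ... > i_r goes down from level s to level l, and
   the last jump, at time k, from level l to level 0. When l = s there is no
   intermediate jump: this is the term r = 0 (empty composition, empty chain),
   which equals f_{k,s,0} f_{k+1,s,s} ... f_{n,s,s}. For l < s the range r = 0
   contributes nothing. *)
Definition phi (R : realType) (u : urn) (n s k : nat) : R :=
  if k == s then \prod_(1 <= j < n.+1) fcoef R u j s s
  else if (0 < k)%N then
    \sum_(1 <= l < (s - k).+1) comp_sum l (s - k) (fun h =>
      chain_sum 1 n l (fun i => phi_term R u n s h i 0))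
  else
    \sum_(1 <= k' < n.+1) \sum_(1 <= l < s.+1) \sum_(0 <= r < (s - l).+1)
      comp_sum r (s - l) (fun h =>
        chain_sum k'.+1 n r (fun i => phi_term R u n s (rcons h l) i k')).

Definition tphi_pos_summable (R : realType) (u : urn) (s k : nat) : Prop :=
  forall l h, (1 <= l <= s - k)%N -> composition l (s - k) h ->
    chain_summable 1 l (fun i => tphi_term R u s h i 0).

Definition tphi_pos (R : realType) (u : urn) (s k : nat) : R :=
  \sum_(1 <= l < (s - k).+1) comp_sum l (s - k) (fun h =>
    chain_series 1 l (fun i => tphi_term R u s h i 0)).

Definition tphi0_summable (R : realType) (u : urn) (s k : nat) : Prop :=
  forall l r h, (1 <= l <= s)%N -> (r <= s - l)%N -> composition r (s - l) h ->
    chain_summable k.+1 r (fun i => tphi_term R u s (rcons h l) i k).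

(* The k-th term (k >= 1) of the series for k = 0; r = 0 as in [phi]. *)
Definition tphi0 (R : realType) (u : urn) (s k : nat) : R :=
  \sum_(1 <= l < s.+1) \sum_(0 <= r < (s - l).+1)
    comp_sum r (s - l) (fun h =>
      chain_series k.+1 r (fun i => tphi_term R u s (rcons h l) i k)).

(* Euler-Gauss definition of the Gamma function on the complex plane minus the
   nonpositive integers, Gamma z = lim n! n^z / (z (z+1) ... (z+n)). *)
Definition natpow (R : realType) (n : nat) (z : R[i]) : R[i] :=
  let r := expR (complex.Re z * ln n%:R) in
  let t := complex.Im z * ln n%:R in
  Complex (r * cos t) (r * sin t).

Definition Gamma_seq (R : realType) (z : R[i]) (n : nat) : R[i] :=
  n`!%:R * natpow n z / \prod_(k < n.+1) (z + k%:R).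

Definition Gamma (R : realType) (z : R[i]) : R[i] :=
  Complex (limn (fun n => complex.Re (Gamma_seq z n)))
          (limn (fun n => complex.Im (Gamma_seq z n))).

Definition binom_poly (F : fieldType) (p : {poly F}) (k : nat) : {poly F} :=
  (k`!%:R)^-1 *: \prod_(i < k) (p - i%:R%:P).

Definition Ppoly (R : realType) (u : urn) (s : nat) : {poly R[i]} :=
  let m := ssize u in
  let s' := minn s m in
  (s'`!%:R / (sigma u)%:R ^+ s') *:
  \sum_(0 <= l < s'.+1)
    ('C(s, l)%:R / 'C(s', l)%:R * (real_complex R (Cst R u)) ^+ l * 'C(m, l)%:R) *:
    binom_poly ((sigma u)%:R *: 'X + ((total_balls u 0)%:R - l%:R)%:P) (s' - l).

Definition Qpoly (R : realType) (u : urn) (s : nat) : {poly R[i]} :=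
  let m := ssize u in
  ((sigma u)%:R ^+ s)^-1 *:
  \sum_(0 <= l < s.+1)
    ('C(s, l)%:R * (real_complex R (Cst R u)) ^+ l * 'C(m, l)%:R * l`!%:R) *:
    ((sigma u)%:R *: 'X + (total_balls u 0)%:R%:P) ^+ (s - l).

(* Main.v *)
Require Import Defs.
From HB Require Import structures.
From mathcomp Require Import all_boot all_order all_algebra.
From mathcomp Require Import complex.
From mathcomp Require Import all_classical all_reals all_analysis.
From mathcomp Require Import measurable_realfun ring lra.

Set Implicit Arguments.
Unset Strict Implicit.
Unset Printing Implicit Defensive.

Import Order.TTheory GRing.Theory Num.Theory.
Import numFieldNormedType.Exports.

Local Open Scope classical_set_scope.
Local Open Scope ring_scope.

(** The shift is chosen so that, given the first n-1 draws, the s-th moment of the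
    shifted content at time n is the polynomial sum_r f_(n,s,r) w^r in the previous
    shifted content w. This comes from the factorial moments of one sample (the
    identities of Vandermonde and Newton), turned into ordinary moments by the
    Stirling numbers: [step_moment]. The moments are therefore weighted sums over
    the paths that go down from level s to a level k while time runs from n down to
    0, a step at time i from level p to level q having the factor f_(i,p,q). Since
    most steps stay on a level, such a path is given by the times and the heights of
    its jumps: these are the sums phi, which satisfy the same recursion in n
    ([phi_recursion], [phi_recursion0], [history_moment_phi]).

    Let D_p(n) be the product of the diagonal factors f_(j,p,p) for j <= n. Then phi
    divided by D_s(n) is a sum over decreasing chains of jump times of products of
    the weights f_(i,p,q) D_q(i-1) / D_p(i), one for each jump ([phi_paths],
    [phi0_paths]). The index n only bounds the times, so the limits are the
    corresponding infinite sums as soon as the weights are dominated by a summable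
    sequence of times ([paths_cvg], [paths0_cvg]). The diagonal factor is
    1 + p Lambda / n + O(1/n^2), hence D_p(n) is of order n^(p Lambda)
    ([diag_prod_limit]), and a jump of height h weighs O(n^(-h Lambda)) times its
    coefficient. The coefficients are bounded, and those of jumps of height 1 are
    O(1/n): the drift at shifted content 0 almost cancels ([fcoef_decay1]). So every
    weight is O(n^(-2 Lambda)), and 2 Lambda > 1 for a large index
    ([jump_dominated]).

    It remains to find the limit of D_s(n) / n^(s Lambda). The diagonal factor
    f_(n+1,s,s) is a quotient of products of terms n + lambda_l and n + t_l, with
    -lambda_l the roots of P_s or Q_s ([fcoef_diag_Ppoly], [fcoef_diag_Qpoly]).
    Gauss's product for the Gamma function turns the product of these quotients into
    the quotient of Gamma values, up to n to the power of the sum of the lambda_l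
    minus that of the t_l; comparison of the first order terms shows that this
    exponent is s Lambda ([prod_rational_limit]). None of the lambda_l is a
    nonpositive integer because the diagonal factors are at least 1, so all these
    values of Gamma are finite and nonzero ([Gamma_seq_cvg]). *)

(** * Sequences with summable increments *)

Section increments.
Variable R : realType.
Implicit Types u v : nat -> R.

Lemma le_increments u v : (forall n, `|u n.+1 - u n| <= v n.+1 - v n) ->
  forall n k, `|u (n + k)%N - u n| <= v (n + k)%N - v n.
Proof.
move=> uv n; elim=> [|k IH]; first by rewrite addn0 !subrr normr0.
rewrite addnS.
have -> : u (n + k).+1 - u n = (u (n + k).+1 - u (n + k)%N) + (u (n + k)%N - u n) by ring.
by apply: le_trans (ler_normD _ _) _; have := uv (n + k)%N; lra.
Qed.

Lemma nondecreasing_increments u v :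
  (forall n, `|u n.+1 - u n| <= v n.+1 - v n) -> nondecreasing_seq v.
Proof.
move=> uv; apply/nondecreasing_seqP => n.
by rewrite -subr_ge0; exact: le_trans (normr_ge0 _) (uv n).
Qed.

Lemma cvgn_le_increments u v :
  (forall n, `|u n.+1 - u n| <= v n.+1 - v n) -> cvgn v -> cvgn u.
Proof.
move=> uv cv; have nv := nondecreasing_increments uv.
(* u + v is nondecreasing, since the decrease of u is paid for by v *)
suff cuv : cvgn (fun n => u n + v n).
  rewrite (_ : u = (fun n => u n + v n) \- v); first exact: is_cvgB.
  by apply/funext => n /=; rewrite addrK.
apply: nondecreasing_is_cvgn.
  by apply/nondecreasing_seqP => n; have := uv n; rewrite ler_norml; lra.
exists (u 0%N - v 0%N + limn v + limn v) => _ [n _ <-].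
have := le_increments uv 0%N n; rewrite add0n ler_norml.
by have := nondecreasing_cvgn_le nv cv n; lra.
Qed.

Lemma nondecreasing_bounded_cvgn u (B : R) :
  (forall n, u n <= u n.+1) -> (forall n, u n <= B) -> cvgn u.
Proof.
move=> nu ub; apply: nondecreasing_is_cvgn; first exact/nondecreasing_seqP.
by exists B => _ [n _ <-].
Qed.

Lemma limn_le_increments u v :
  (forall n, `|u n.+1 - u n| <= v n.+1 - v n) -> cvgn v ->
  forall n, `|limn u - u n| <= limn v - v n.
Proof.
move=> uv cv n; have cu := cvgn_le_increments uv cv.
have nv := nondecreasing_increments uv.
have : (fun k => `|u k - u n|) @ \oo --> `|limn u - u n|.
  by apply: cvg_norm; apply: cvgB cu _; exact: cvg_cst.
move=> cuu; rewrite -(cvg_lim _ cuu)//; apply: limr_le; first by apply: cvgP cuu.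
near=> N; have nN : (n <= N)%N by near: N; exact: nbhs_infty_ge.
rewrite -(subnKC nN); apply: le_trans (le_increments uv _ _) _.
by rewrite lerD2r nondecreasing_cvgn_le.
Unshelve. all: by end_near. Qed.
End increments.

(** * Complex sequences of the form 1 + a/n + O(1/n^2) *)

Section complex_sequences.
Variable R : realType.
Local Notation C := R[i].
Local Notation nc := (@Normc.normc R).
Implicit Types (e u : nat -> C) (z a : C).

Lemma normc_ge0 z : 0 <= nc z.
Proof. by case: z => x y /=; exact: sqrtr_ge0. Qed.

Lemma normc_real (x : R) : nc (real_complex R x) = `|x|.
Proof. by rewrite /= expr0n /= addr0 sqrtr_sqr. Qed.

Lemma normc_nat n : nc n%:R = n%:R.
Proof. by rewrite -(rmorph_nat (real_complex R)) normc_real ger0_norm. Qed.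

Lemma normc_Re z : `|complex.Re z| <= nc z.
Proof.
case: z => x y /=; rewrite -sqrtr_sqr; apply: ler_wsqrtr.
by rewrite lerDl sqr_ge0.
Qed.

Lemma normc_Im z : `|complex.Im z| <= nc z.
Proof.
case: z => x y /=; rewrite -sqrtr_sqr; apply: ler_wsqrtr.
by rewrite lerDr sqr_ge0.
Qed.

Lemma normc_le_ReIm (x y : R) : nc (Complex x y) <= `|x| + `|y|.
Proof.
rewrite /= -(@ler_pXn2r _ 2) ?nnegrE ?sqrtr_ge0 ?addr_ge0//.
rewrite sqr_sqrtr ?addr_ge0 ?sqr_ge0// -(real_normK (num_real x)).
by rewrite -(real_normK (num_real y)) sqrrD -addrA lerD2l lerDr mulrn_wge0// mulr_ge0.
Qed.

Lemma normcB z z' : nc (z - z') <= nc z + nc z'.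
Proof. by rewrite -(normcN z'); exact: le_normcD. Qed.

Lemma normc_eq0 z : (nc z == 0) = (z == 0).
Proof.
by apply/eqP/eqP => [|->]; [exact: Normc.eq0_normc|exact: Normc.normc0].
Qed.

Lemma normc_gt0 z : (0 < nc z) = (z != 0).
Proof. by rewrite lt0r normc_ge0 andbT normc_eq0. Qed.

(** Complex sequences are handled through their real and imaginary parts, as in
    the definition of Gamma. *)
Definition ccvg u z :=
  (fun n => complex.Re (u n)) @ \oo --> complex.Re z /\
  (fun n => complex.Im (u n)) @ \oo --> complex.Im z.

Lemma ccvg_unique u z z' : ccvg u z -> ccvg u z' -> z = z'.
Proof.
case: z z' => [x y] [x' y'] [cx cy] [cx' cy'] /=.
congr Complex; first exact: (cvg_unique _ cx cx').
exact: (cvg_unique _ cy cy').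
Qed.

Lemma ReM z z' :
  complex.Re (z * z') = complex.Re z * complex.Re z' - complex.Im z * complex.Im z'.
Proof. by case: z z' => ? ? []. Qed.

Lemma ImM z z' :
  complex.Im (z * z') = complex.Re z * complex.Im z' + complex.Im z * complex.Re z'.
Proof. by case: z z' => ? ? []. Qed.

Lemma ccvgM u v z z' : ccvg u z -> ccvg v z' -> ccvg (fun n => u n * v n) (z * z').
Proof.
move=> [ur ui] [vr vi]; split.
  by rewrite ReM; under eq_fun do rewrite ReM; apply: cvgB; exact: cvgM.
by rewrite ImM; under eq_fun do rewrite ImM; apply: cvgD; exact: cvgM.
Qed.

Lemma ccvg_cst z : ccvg (fun=> z) z.
Proof. by split; exact: cvg_cst. Qed.

Lemma ccvg_prod k (u : 'I_k -> nat -> C) (z : 'I_k -> C) :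
  (forall l, ccvg (u l) (z l)) ->
  ccvg (fun n => \prod_(l < k) u l n) (\prod_(l < k) z l).
Proof.
elim: k u z => [|k IH] u z uz.
  under eq_fun do rewrite big_ord0.
  by rewrite big_ord0; exact: ccvg_cst.
under eq_fun do rewrite big_ord_recr /=.
by rewrite big_ord_recr; apply: ccvgM; [apply: IH => l; exact: uz|exact: uz].
Qed.

Lemma ccvg_real (u : nat -> R) (x : R) :
  u @ \oo --> x -> ccvg (fun n => real_complex R (u n)) (real_complex R x).
Proof. by move=> ux; split => //=; exact: cvg_cst. Qed.

Lemma ccvgS u z : ccvg (fun n => u n.+1) z -> ccvg u z.
Proof.
case=> ur ui; split; first by rewrite -(cvg_shiftS (fun n => complex.Re (u n))).
by rewrite -(cvg_shiftS (fun n => complex.Im (u n))).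
Qed.

Lemma ccvg_shift u z : ccvg u z -> ccvg (fun n => u n.+1) z.
Proof.
case=> ur ui; split; first by rewrite (cvg_shiftS (fun n => complex.Re (u n))).
by rewrite (cvg_shiftS (fun n => complex.Im (u n))).
Qed.

Lemma eq_ccvg u v z : (forall n, u n = v n) -> ccvg u z -> ccvg v z.
Proof. by move=> uv; rewrite (_ : u = v)//; exact/funext. Qed.

(** An expansion to second order of a sequence tending to 1; it is indexed by n+1
    so that it constrains all terms, with one constant K. *)
Definition asym e a :=
  exists K : R, forall n, nc (e n - 1 - a / n.+1%:R) <= K / n.+1%:R ^+ 2.

Lemma eq_asym e e' a : (forall n, e n = e' n) -> asym e a -> asym e' a.
Proof. by move=> ee; rewrite (_ : e = e')//; exact/funext. Qed.

Lemma asym_ge0 K (f : nat -> R) : (forall n, 0 <= f n) ->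
  (forall n, f n <= K / n.+1%:R ^+ 2) -> 0 <= K.
Proof. by move=> f0 /(_ 0%N); rewrite expr1n divr1; exact: le_trans. Qed.

Lemma asym_near e a : asym e a ->
  exists2 K : R, 0 <= K & forall n, nc (e n - 1) <= K / n.+1%:R.
Proof.
case=> K hK; have K0 := asym_ge0 (fun n => normc_ge0 _) hK.
exists (K + nc a) => [|n]; first by rewrite addr_ge0 ?normc_ge0.
rewrite (_ : e n - 1 = (e n - 1 - a / n.+1%:R) + a / n.+1%:R); last by rewrite subrK.
apply: le_trans (le_normcD _ _) _; rewrite mulrDl lerD//; last first.
  by rewrite Normc.normcM Normc.normcV normc_nat.
apply: le_trans (hK n) _; rewrite ler_wpM2l// lef_pV2 ?posrE ?exprn_gt0//.
by rewrite -natrX ler_nat expnS leq_pmulr// expn_gt0.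
Qed.

Lemma asymM e e' a a' : asym e a -> asym e' a' ->
  asym (fun n => e n * e' n) (a + a').
Proof.
move=> ea ea'; have [L L0 hL] := asym_near ea'.
case: ea ea' => K hK [K' hK'].
have K0 := asym_ge0 (fun n => normc_ge0 _) hK.
have K'0 := asym_ge0 (fun n => normc_ge0 _) hK'.
exists (K * (1 + L) + K' * (1 + nc a) + nc a * nc a') => n.
have x1 : 1 <= n.+1%:R :> R by rewrite ler1n.
have xC : n.+1%:R != 0 :> C by rewrite pnatr_eq0.
set r := e n - 1 - a / n.+1%:R; set r' := e' n - 1 - a' / n.+1%:R.
rewrite (_ : _ - _ = r * (1 + (e' n - 1)) + r' * (1 + a / n.+1%:R)
  + a * a' / n.+1%:R ^+ 2); last by rewrite /r /r'; field.
rewrite [leRHS]mulrDl [in leRHS]mulrDl.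
apply: le_trans (le_normcD _ _) (lerD _ _); last first.
  by rewrite !Normc.normcM Normc.normcV -natrX normc_nat natrX.
apply: le_trans (le_normcD _ _) (lerD _ _); rewrite Normc.normcM.
  rewrite mulrAC ler_pM ?normc_ge0 ?hK//.
  apply: le_trans (le_normcD _ _) _; rewrite Normc.normc1 lerD2l.
  by apply: le_trans (hL n) _; rewrite ler_pdivrMr ?ltr0n// ler_peMr.
rewrite mulrAC ler_pM ?normc_ge0 ?hK'//.
apply: le_trans (le_normcD _ _) _; rewrite Normc.normc1 lerD2l.
by rewrite Normc.normcM Normc.normcV normc_nat ler_pdivrMr ?ltr0n// ler_peMr ?normc_ge0.
Qed.

Lemma asym_prod k (e : 'I_k -> nat -> C) (a : 'I_k -> C) :
  (forall l, asym (e l) (a l)) ->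
  asym (fun n => \prod_(l < k) e l n) (\sum_(l < k) a l).
Proof.
elim: k e a => [|k IH] e a ea.
  exists 0 => n; rewrite !big_ord0 subrr sub0r mul0r oppr0 mul0r.
  by rewrite Normc.normc0.
rewrite big_ord_recr /=; under eq_fun do rewrite big_ord_recr /=.
by apply: asymM; [apply: IH => l; exact: ea|exact: ea].
Qed.

(** A sequence tending to 1 is bounded below from some index on, and the finitely
    many earlier terms are not 0. *)
Lemma asym_lower e a : asym e a -> (forall n, e n != 0) ->
  exists2 c : R, 0 < c & forall n, c <= nc (e n).
Proof.
move=> /asym_near[K K0 hK] e0.
have [N hN] : exists N, forall n, (N <= n)%N -> 2^-1 <= nc (e n).
  exists (Num.bound (2 * K)) => n Nn.
  have nK : 2 * K <= n.+1%:R.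
    apply: ltW (lt_le_trans (archi_boundP _) _); first exact: mulr_ge0.
    by rewrite ler_nat (leq_trans Nn).
  have := normcB (e n) (e n - 1); rewrite subKr Normc.normc1.
  have : K / n.+1%:R <= 2^-1 by rewrite ler_pdivrMr ?ltr0n// mulrC ler_pdivlMr// mulrC.
  by move: (hK n); set q := K / _ => *; lra.
have [c c0 hc] : exists2 c, 0 < c & forall n, (n < N)%N -> c <= nc (e n).
  elim: N {hN} => [|N [c c0 IH]]; first by exists 1.
  exists (Num.min c (nc (e N))); first by rewrite lt_min c0 normc_gt0 e0.
  by move=> n; rewrite ltnS leq_eqVlt ge_min => /predU1P[->|/IH->//]; rewrite lexx orbT.
exists (Num.min c 2^-1); first by rewrite lt_min c0 invr_gt0 ltr0n.
by move=> n; rewrite ge_min; case: (ltnP n N) => [/hc->//|/hN->]; rewrite orbT.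
Qed.

Lemma asymV e a : asym e a -> (forall n, e n != 0) ->
  asym (fun n => (e n)^-1) (- a).
Proof.
move=> ea e0; have [c c0 hc] := asym_lower ea e0; case: ea => K hK.
have K0 := asym_ge0 (fun n => normc_ge0 _) hK.
exists ((K * (1 + nc a) + nc a ^+ 2) / c) => n.
have xC : n.+1%:R != 0 :> C by rewrite pnatr_eq0.
have x1 : 1 <= n.+1%:R :> R by rewrite ler1n.
set r := e n - 1 - a / n.+1%:R.
rewrite (_ : _ - _ = (r * (a / n.+1%:R - 1) + (a / n.+1%:R) ^+ 2) / e n); last first.
  by rewrite /r; field; rewrite e0 nat1r.
rewrite Normc.normcM Normc.normcV mulrAC.
apply: ler_pM; rewrite ?normc_ge0 ?invr_ge0 ?normc_ge0//; last first.
  by rewrite lef_pV2 ?posrE// normc_gt0.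
rewrite [leRHS]mulrDl; apply: le_trans (le_normcD _ _) (lerD _ _); last first.
  by rewrite expr2 !Normc.normcM Normc.normcV normc_nat -expr2 expr_div_n.
rewrite Normc.normcM mulrAC ler_pM ?normc_ge0 ?hK//.
apply: le_trans (normcB _ _) _; rewrite Normc.normc1 addrC lerD2l.
by rewrite Normc.normcM Normc.normcV normc_nat ler_pdivrMr ?ltr0n// ler_peMr ?normc_ge0.
Qed.

(** Two ways of expanding the same sequence yield an identity between their first
    order terms. *)
Lemma asym_unique e a a' : asym e a -> asym e a' -> a = a'.
Proof.
move=> [K hK] [K' hK']; apply/eqP; rewrite -subr_eq0 -normc_eq0.
have KK : 0 <= K + K'.
  by rewrite addr_ge0 ?(asym_ge0 (fun n => normc_ge0 _) hK) ?(asym_ge0 (fun n => normc_ge0 _) hK').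
have haa n : nc (a - a') <= (K + K') / n.+1%:R.
  have xC : n.+1%:R != 0 :> C by rewrite pnatr_eq0.
  have : nc ((a - a') / n.+1%:R) <= (K + K') / n.+1%:R ^+ 2.
    rewrite (_ : _ / _ = (e n - 1 - a' / n.+1%:R) - (e n - 1 - a / n.+1%:R)); last by ring.
    by rewrite [leRHS]mulrDl [leRHS]addrC; apply: le_trans (normcB _ _) (lerD _ _).
  rewrite Normc.normcM Normc.normcV normc_nat expr2 invfM mulrA.
  by rewrite ler_pM2r ?invr_gt0 ?ltr0n.
rewrite eq_le normc_ge0 andbT leNgt; apply/negP => aa0.
have /archi_boundP : 0 <= (K + K') / nc (a - a') by rewrite divr_ge0 ?normc_ge0.
rewrite ltr_pdivrMr// => h.
have := haa (Num.bound ((K + K') / nc (a - a'))).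
rewrite ler_pdivlMr ?ltr0n// -natr1 mulrDr mulr1.
by move: h; rewrite mulrC; lra.
Qed.

End complex_sequences.

(** * Infinite products and the Gamma function *)

Section gamma.
Variable R : realType.
Local Notation C := R[i].
Local Notation nc := (@Normc.normc R).
Implicit Types (e u : nat -> C) (z a : C).

Lemma ccvg_le_increments u (v : nat -> R) :
  (forall n, nc (u n.+1 - u n) <= v n.+1 - v n) -> cvgn v -> exists z, ccvg u z.
Proof.
move=> uv cv.
have cr : cvgn (fun n => complex.Re (u n)).
  apply: (cvgn_le_increments _ cv) => n; apply: le_trans (uv n).
  by rewrite (_ : _ - _ = complex.Re (u n.+1 - u n)) ?normc_Re// raddfB.
have ci : cvgn (fun n => complex.Im (u n)).
  apply: (cvgn_le_increments _ cv) => n; apply: le_trans (uv n).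
  by rewrite (_ : _ - _ = complex.Im (u n.+1 - u n)) ?normc_Im// raddfB.
by exists (Complex (limn (fun n => complex.Re (u n))) (limn (fun n => complex.Im (u n)))).
Qed.

Definition inv_sq_sum n : R := \sum_(k < n) (k.+1%:R ^+ 2)^-1.

Lemma inv_sq_sum_le n : inv_sq_sum n <= 2 - 2 / n.+1%:R.
Proof.
elim: n => [|n IH]; first by rewrite /inv_sq_sum big_ord0 divr1 subrr.
rewrite /inv_sq_sum big_ord_recr /=; apply: le_trans (lerD IH (lexx _)) _.
have x0 : 0 < n.+1%:R :> R by rewrite ltr0n.
have n0 : 0 <= n%:R :> R by rewrite ler0n.
rewrite -subr_ge0 (_ : _ - _ = n%:R / (n.+1%:R ^+ 2 * n.+2%:R)).
  by rewrite divr_ge0// ?mulr_ge0 ?exprn_ge0.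
by rewrite -(natr1 n.+1) -(natr1 n); field; rewrite -?natrD ?pnatr_eq0 !gt_eqF//; lra.
Qed.

Lemma inv_sq_sum_cvg : cvgn inv_sq_sum.
Proof.
apply: (@nondecreasing_bounded_cvgn _ _ 2) => n.
  by rewrite /inv_sq_sum big_ord_recr lerDl invr_ge0 exprn_ge0.
by apply: le_trans (inv_sq_sum_le n) _; rewrite gerBl divr_ge0.
Qed.

(** The products stay bounded by the exponential of the sum of the |e n - 1|, so
    that their increments are summable along with e n - 1. *)
Lemma asym0_ccvg e u : asym e 0 -> (forall n, u n.+1 = u n * e n) ->
  exists z, ccvg u z.
Proof.
move=> [K hK] ue.
have {}hK n : nc (e n - 1) <= K * (inv_sq_sum n.+1 - inv_sq_sum n).
  rewrite /inv_sq_sum big_ord_recr /= addrAC subrr add0r.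
  by have := hK n; rewrite mul0r subr0.
have K0 : 0 <= K.
  have := le_trans (normc_ge0 _) (hK 0%N).
  by rewrite /inv_sq_sum big_ord1 big_ord0 subr0 expr1n invr1 mulr1.
have uM n : nc (u n) <= nc (u 0%N) * expR (K * inv_sq_sum n).
  elim: n => [|n IH]; first by rewrite /inv_sq_sum big_ord0 mulr0 expR0 mulr1.
  rewrite ue Normc.normcM.
  rewrite -(subrK (inv_sq_sum n) (inv_sq_sum n.+1)) addrC mulrDr expRD mulrA.
  apply: ler_pM => //; rewrite ?normc_ge0//.
  rewrite -(subrK 1 (e n)) addrC; apply: le_trans (le_normcD _ _) _.
  by rewrite Normc.normc1; apply: le_trans (expR_ge1Dx _); rewrite lerD2l.
have uM2 n : nc (u n) <= nc (u 0%N) * expR (K * 2).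
  apply: le_trans (uM n) _; rewrite ler_wpM2l ?normc_ge0// ler_expR ler_wpM2l//.
  by apply: le_trans (inv_sq_sum_le n) _; rewrite gerBl divr_ge0.
set M := nc (u 0%N) * _ in uM2.
apply: (@ccvg_le_increments _ (fun n => M * K * inv_sq_sum n)) => [n|].
  rewrite ue -{2}(mulr1 (u n)) -mulrBr Normc.normcM -mulrBr -mulrA.
  by rewrite ler_pM ?normc_ge0.
by apply: is_cvgMr; exact: inv_sq_sum_cvg.
Qed.

(** The inverse sequence converges for the same reason, which keeps the limit
    away from 0. *)
Lemma asym0_ccvg_neq0 e u : asym e 0 -> (forall n, u n.+1 = u n * e n) ->
  (forall n, e n != 0) -> u 0%N != 0 -> exists2 z, ccvg u z & z != 0.
Proof.
move=> e0 ue en0 u0; have [z uz] := asym0_ccvg e0 ue; exists z => //.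
have u_neq0 n : u n != 0 by elim: n => [//|n IH]; rewrite ue mulf_neq0.
have [||z' vz'] := @asym0_ccvg (fun n => (e n)^-1) (fun n => (u n)^-1).
- by rewrite -oppr0; exact: asymV.
- by move=> n; rewrite ue invfM.
apply/eqP => z0; have : ccvg (fun n => u n * (u n)^-1) (z * z') by exact: ccvgM.
have -> : (fun n => u n * (u n)^-1) = (fun=> 1) by apply/funext => n; rewrite divff.
move/(ccvg_unique (ccvg_cst 1)); rewrite z0 mul0r => /eqP.
by rewrite oner_eq0.
Qed.

(** From 1 + y <= exp y at y = x and y = -x. *)
Lemma expR_second_order (x : R) : `|expR x - 1 - x| <= x ^+ 2 * expR `|x|.
Proof.
have h1 := expR_ge1Dx x; have h2 := expR_ge1Dx (- x).
have h3 : expR x * expR (- x) = 1 by rewrite -expRD subrr expR0.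
have ex := expR_gt0 x.
have h4 : expR x - 1 - x <= x * (expR x - 1) by nra.
rewrite ger0_norm; last lra.
apply: le_trans h4 _; have [x0|x0] := ger0P x.
  by rewrite expr2 -mulrA ler_wpM2l//; nra.
have h5 : 1 <= expR (- x) by lra.
have h6 : x * (expR x - 1) <= x ^+ 2 by nra.
by apply: le_trans h6 _; rewrite ler_peMr ?sqr_ge0.
Qed.

Lemma norm_increment_le (f df : R -> R) (x B : R) :
  (forall y : R, is_derive y 1 f (df y)) -> (forall y : R, `|y| <= `|x| -> `|df y| <= B) ->
  `|f x - f 0| <= B * `|x|.
Proof.
move=> fd dB.
have cf (a b : R) : {within `[a, b], continuous f}.
  apply: continuous_subspaceT => y; apply: differentiable_continuous.
  by apply/derivable1_diffP; case: (fd y).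
have [x0|x0] := lerP 0 x.
  have [c + ->] := MVT_segment x0 (fun y _ => fd y) (cf _ _).
  rewrite in_itv /= subr0 normrM => /andP[c0 cx].
  by rewrite ler_wpM2r// dB// !ger0_norm.
have [c + fc] := MVT_segment (ltW x0) (fun y _ => fd y) (cf _ _).
rewrite in_itv /= distrC fc sub0r normrM normrN => /andP[c0 cx].
by rewrite ler_wpM2r// dB// !ler0_norm ?lerN2// ltW.
Qed.

Lemma norm_sin_le (x : R) : `|sin x| <= `|x|.
Proof.
rewrite -[sin x]subr0 -(@sin0 R) -[leRHS]mul1r.
by apply: (norm_increment_le (df := cos)) => y _; exact: cos_max.
Qed.

Lemma cos_second_order (x : R) : `|cos x - 1| <= x ^+ 2.
Proof.
rewrite -(@cos0 R) -real_normK ?num_real// expr2.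
apply: (norm_increment_le (df := fun y => - sin y)) => y yx.
by rewrite normrN; exact: le_trans (norm_sin_le y) yx.
Qed.

Lemma sin_second_order (x : R) : `|sin x - x| <= `|x| ^+ 3.
Proof.
have -> : sin x - x = (sin x - x) - (sin 0 - 0) by rewrite sin0 !subr0.
rewrite exprSr; apply: (norm_increment_le (f := fun y => sin y - y)
  (df := fun y => cos y - 1)) => y yx.
apply: le_trans (cos_second_order y) _.
by rewrite -real_normK ?num_real// lerXn2r ?nnegrE.
Qed.

Lemma ln_increment n (L := ln n.+2%:R - ln n.+1%:R : R) (x := n.+1%:R^-1 : R) :
  [/\ 0 <= L, L <= x & `|L - x| <= x ^+ 2].
Proof.
have n1 : (n.+1%:R : R) \is Num.pos by rewrite posrE ltr0n.
have n2 : (n.+2%:R : R) \is Num.pos by rewrite posrE ltr0n.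
have x0 : 0 < x by rewrite invr_gt0 ltr0n.
have y0 : 0 < n.+2%:R^-1 :> R by rewrite invr_gt0 ltr0n.
have Lx : L <= x.
  rewrite /L -ln_div// (_ : _ / _ = 1 + x); first by apply: le_ln1Dx; lra.
  by rewrite -natr1 mulrDl mul1r divff ?pnatr_eq0.
have yL : n.+2%:R^-1 <= L.
  rewrite -lerN2 /L opprB -ln_div// (_ : _ / _ = 1 - n.+2%:R^-1).
    by apply: le_ln1Dx; rewrite ltrN2 invf_lt1 ?ltr0n// ltr1n.
  by rewrite -[in LHS](addrK 1 n.+1%:R) natr1 mulrBl mul1r divff ?pnatr_eq0.
split => //; first by apply: le_trans yL; exact: ltW.
rewrite ler0_norm ?subr_le0// opprB lerBlDr -lerBlDl; apply: le_trans yL.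
rewrite /x -subr_ge0 (_ : _ - _ = (n.+1%:R ^+ 2 * n.+2%:R)^-1).
  by rewrite invr_ge0 mulr_ge0 ?exprn_ge0.
have n0 : 0 <= n%:R :> R by rewrite ler0n.
by rewrite -(natr1 n.+1) -(natr1 n); field; rewrite -?natrD ?pnatr_eq0 !gt_eqF//; lra.
Qed.

Lemma natpowD n (z z' : C) : natpow n (z + z') = natpow n z * natpow n z'.
Proof.
case: z z' => a b [a' b']; rewrite /natpow /= !mulrDl expRD cosD sinD.
by congr Complex; ring.
Qed.

Lemma natpow0 n : natpow n (0 : C) = 1.
Proof. by rewrite /natpow /= !mul0r expR0 cos0 sin0 mulr1 mulr0. Qed.

Lemma natpow_neq0 n z : natpow n z != 0.
Proof.
apply/eqP => h; have := natpowD n z (- z).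
by rewrite subrr natpow0 h mul0r => /eqP; rewrite oner_eq0.
Qed.

Lemma natpow_sum n k (z : 'I_k -> C) :
  natpow n (\sum_(l < k) z l) = \prod_(l < k) natpow n (z l).
Proof.
elim: k z => [|k IH] z; first by rewrite !big_ord0 natpow0.
by rewrite !big_ord_recr natpowD IH.
Qed.

Lemma natpow_real n (x : R) :
  natpow n.+1 (real_complex R x) = real_complex R (n.+1%:R `^ x).
Proof.
rewrite /natpow /= mul0r cos0 sin0 mulr1 mulr0.
by rewrite /powR pnatr_eq0.
Qed.

(** The quotient is exp (z L) with L = ln (n+2) - ln (n+1); its modulus and its
    argument are expanded separately, and the expansions multiplied. *)
Lemma asym_natpow z : asym (fun n => natpow n.+2 z / natpow n.+1 z) z.
Proof.
case: z => a b.
pose L n : R := ln n.+2%:R - ln n.+1%:R.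
have xE n : (n.+1%:R : C)^-1 = real_complex R (n.+1%:R)^-1.
  by rewrite -(rmorph_nat (real_complex R)) fmorphV.
pose er n := real_complex R (expR (a * L n)).
pose ei n := Complex (cos (b * L n)) (sin (b * L n)).
have era : asym er (real_complex R a).
  exists (a ^+ 2 * expR `|a| + `|a|) => n; have [L0 Lx LL] := ln_increment n.
  rewrite -/(L n) in L0 Lx LL; set x := n.+1%:R^-1 in Lx LL.
  have x1 : x <= 1 by rewrite invf_le1 ?ler1n ?ltr0n.
  rewrite /er xE -(rmorph1 (real_complex R)) -rmorphM -!rmorphB normc_real.
  rewrite -exprVn -/x.
  rewrite (_ : _ - _ = (expR (a * L n) - 1 - a * L n) + a * (L n - x)); last by ring.
  rewrite mulrDl; apply: le_trans (ler_normD _ _) (lerD _ _); last first.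
    by rewrite normrM ler_wpM2l.
  apply: le_trans (expR_second_order _) _; rewrite [leRHS]mulrAC exprMn.
  rewrite ler_pM ?expR_ge0//; first by rewrite mulr_ge0 ?sqr_ge0.
    by rewrite ler_wpM2l ?sqr_ge0// lerXn2r ?nnegrE// (le_trans L0).
  by rewrite ler_expR normrM ler_piMr// ger0_norm// (le_trans Lx).
have eia : asym ei (Complex 0 b).
  exists (b ^+ 2 + `|b| ^+ 3 + `|b|) => n; have [L0 Lx LL] := ln_increment n.
  rewrite -/(L n) in L0 Lx LL; set x := n.+1%:R^-1 in Lx LL.
  have x1 : x <= 1 by rewrite invf_le1 ?ler1n ?ltr0n.
  have x0 : 0 <= x by exact: le_trans Lx.
  rewrite xE -exprVn -/x.
  rewrite (_ : _ - _ = Complex (cos (b * L n) - 1)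
    ((sin (b * L n) - b * L n) + b * (L n - x))); last first.
    by rewrite /ei /=; simpc; congr Complex; ring.
  apply: le_trans (normc_le_ReIm _ _) _; rewrite 2!mulrDl -[leRHS]addrA lerD//.
    apply: le_trans (cos_second_order _) _.
    by rewrite exprMn ler_wpM2l ?sqr_ge0// lerXn2r ?nnegrE.
  apply: le_trans (ler_normD _ _) (lerD _ _); last by rewrite normrM ler_wpM2l.
  apply: le_trans (sin_second_order _) _.
  rewrite normrM exprMn ler_wpM2l ?exprn_ge0// ger0_norm//.
  apply: (@le_trans _ _ (x ^+ 3)); first by rewrite lerXn2r ?nnegrE.
  by rewrite [leLHS]exprS ler_piMl// sqr_ge0.
have := asymM era eia.
rewrite (_ : real_complex R a + Complex 0 b = Complex a b); last first.
  by congr Complex; rewrite ?addr0 ?add0r.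
apply: eq_asym => n; apply: (mulIf (natpow_neq0 n.+1 (Complex a b))).
rewrite divfK ?natpow_neq0// /er /ei /natpow /=.
have -> : ln n.+2%:R = L n + ln n.+1%:R by rewrite subrK.
move: (L n) => l; rewrite !mulrDr expRD cosD sinD.
by simpc; congr Complex; ring.
Qed.

Lemma asym_1Ddiv z : asym (fun n => (z + n.+2%:R) / n.+2%:R) z.
Proof.
exists (nc z) => n.
rewrite (_ : _ - _ = - z / (n.+1%:R * n.+2%:R)); last first.
  by field; rewrite !nat1r -!natrD ?pnatr_eq0.
rewrite Normc.normcM Normc.normcV normcN -natrM normc_nat ler_wpM2l ?normc_ge0//.
by rewrite lef_pV2 ?posrE ?ltr0n// -?natrX ?ler_nat ?leq_mul// expn_gt0.
Qed.

Lemma Gamma_seqS z n : Gamma_seq z n.+2 =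
  Gamma_seq z n.+1 * (natpow n.+2 z / natpow n.+1 z * ((z + n.+2%:R) / n.+2%:R)^-1).
Proof.
rewrite /Gamma_seq [in LHS]big_ord_recr /= factS natrM !invfM invrK.
move: (\prod_(_ < _) _)^-1 (z + _)^-1 => p q.
by field; rewrite natpow_neq0.
Qed.

(** The successive quotients of the Gauss sequence are 1 + O(1/n^2), the two
    terms z/n cancelling. *)
Lemma Gamma_seq_cvg z : (forall k, z + k%:R != 0) ->
  ccvg (Gamma_seq z) (Gamma z) /\ Gamma z != 0.
Proof.
move=> z0.
pose e n := natpow n.+2 z / natpow n.+1 z * ((z + n.+2%:R) / n.+2%:R)^-1.
have [||||w uw w0] := @asym0_ccvg_neq0 e (fun n => Gamma_seq z n.+1).
- rewrite -(subrr z); apply: asymM (asym_natpow z) (asymV (asym_1Ddiv z) _) => n.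
  by rewrite mulf_neq0 ?invr_eq0 ?pnatr_eq0 ?z0.
- by move=> n; exact: Gamma_seqS.
- by move=> n; rewrite !(mulf_neq0, invr_neq0) ?natpow_neq0 ?z0 ?pnatr_eq0.
- rewrite /Gamma_seq !(mulf_neq0, invr_neq0) ?natpow_neq0 ?pnatr_eq0 -?lt0n ?fact_gt0//.
  by apply/prodf_neq0 => k _; exact: z0.
have [gr gi] := ccvgS uw.
suff -> : Gamma z = w by split => //; exact: ccvgS.
rewrite /Gamma (cvg_lim _ gr)// (cvg_lim _ gi)//.
by case: w {uw w0 gr gi}.
Qed.

End gamma.

Section gamma_product.
Variable R : realType.
Local Notation C := R[i].
Local Notation rc := (real_complex R).

Lemma asym_ccvg1 (e : nat -> C) a : asym e a -> ccvg e 1.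
Proof.
move=> /asym_near[K K0 hK].
have cvg1 (f : C -> R) (r : R) : (forall n, `|f (e n) - r| <= Normc.normc (e n - 1)) ->
    (fun n => f (e n)) @ \oo --> r.
  move=> fe; rewrite -[r]addr0; under eq_fun do rewrite -[f _](subrKC r).
  apply: cvgD; first exact: cvg_cst.
  have KO : (fun n : nat => K * n.+1%:R^-1) @ \oo --> (0 : R).
    by rewrite -[X in _ --> X](mulr0 K); apply: cvgMr; exact: cvg_harmonic.
  apply: (squeeze_cvgr (f := fun n : nat => - (K * n.+1%:R^-1))
     (h := fun n : nat => K * n.+1%:R^-1)) => //.
    by near=> n; rewrite -ler_norml; apply: le_trans (fe n) (hK n).
  by rewrite -[X in _ --> X]oppr0; exact: cvgN.
split.
- apply: (@cvg1 (@complex.Re R)) => n.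
  rewrite (_ : _ - _ = complex.Re (e n - 1)) ?normc_Re//.
  by rewrite raddfB.
- apply: (@cvg1 (@complex.Im R)) => n.
  rewrite (_ : _ - _ = complex.Im (e n - 1)) ?normc_Im//.
  by rewrite raddfB.
Unshelve. all: by end_near. Qed.

Lemma prod_Gamma_seq k (z : 'I_k -> C) n : (forall l j, z l + j%:R != 0) ->
  \prod_(j < n.+1) \prod_(l < k) (z l + j%:R) * \prod_(l < k) Gamma_seq (z l) n
  = n`!%:R ^+ k * natpow n (\sum_(l < k) z l).
Proof.
move=> z0; rewrite exchange_big /= -big_split natpow_sum /=.
rewrite -[in X in _ ^+ X](card_ord k) -prodr_const -big_split /=.
apply: eq_bigr => l _; rewrite /Gamma_seq mulrC divfK//.
by apply/prodf_neq0 => j _; exact: z0.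
Qed.

(** Both sides of the quotient of products are compared with Gauss sequences;
    the first order of f forces the powers of n left over to be those of the
    normalization. *)
Lemma prod_rational_limit k (t lam : 'I_k -> C) (f : nat -> R) (x c : R) :
  (forall l j, t l + j%:R != 0) -> (forall n, f n.+1 != 0) ->
  (forall n, rc (f n.+1) = (\prod_(l < k) (lam l + n%:R)) / \prod_(l < k) (t l + n%:R)) ->
  asym (fun n => rc (f n.+2)) (rc x) ->
  (fun n : nat => \prod_(1 <= j < n.+1) f j / n%:R `^ x) @ \oo --> c ->
  rc c = \prod_(l < k) (Gamma (t l) / Gamma (lam l)).
Proof.
move=> t0 f0 fE fx cc.
have lam0 l j : lam l + j%:R != 0.
  have : rc (f j.+1) != 0 by rewrite fmorph_eq0.
  by rewrite fE mulf_eq0 negb_or => /andP[/prodf_neq0 ->].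
have xE : rc x = \sum_(l < k) lam l - \sum_(l < k) t l.
  apply: asym_unique fx _.
  have a1 (z : 'I_k -> C) : asym (fun n => \prod_(l < k) (1 + z l / n.+1%:R)) (\sum_(l < k) z l).
    by apply: asym_prod => l; exists 0 => n; rewrite (addrC 1) addrK subrr Normc.normc0 mul0r.
  have E (z : C) n : 1 + z / n.+1%:R = (z + n.+1%:R) / n.+1%:R.
    by rewrite mulrDl divff ?pnatr_eq0// addrC.
  have dt n : \prod_(l < k) (1 + t l / n.+1%:R) != 0.
    by apply/prodf_neq0 => l _; rewrite E mulf_neq0 ?invr_eq0 ?pnatr_eq0.
  apply: eq_asym _ (asymM (a1 lam) (asymV (a1 t) dt)) => n.
  rewrite fE; under eq_bigr do rewrite E; rewrite big_split /=.
  under [X in _ / X]eq_bigr do rewrite E; rewrite [in X in _ / X]big_split /=.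
  rewrite invfM mulrACA divff ?mulr1//.
  by apply/prodf_neq0 => l _; rewrite invr_eq0 pnatr_eq0.
have gl l := Gamma_seq_cvg (lam0 l); have gt l := Gamma_seq_cvg (t0 l).
have cc' : ccvg (fun n => rc (\prod_(1 <= j < n.+2) f j / n%:R `^ x)) (rc c).
  have := ccvgM (ccvg_real cc) (ccvgS (u := fun n => rc (f n.+1)) (asym_ccvg1 fx)).
  rewrite mulr1; apply: eq_ccvg => n.
  by rewrite -rmorphM [in RHS]big_nat_recr//= mulrAC.
have key n : rc (\prod_(1 <= j < n.+3) f j / n.+1%:R `^ x) *
    \prod_(l < k) Gamma_seq (lam l) n.+1 = \prod_(l < k) Gamma_seq (t l) n.+1.
  have nt : \prod_(j < n.+2) \prod_(l < k) (t l + j%:R) != 0.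
    by apply/prodf_neq0 => j _; apply/prodf_neq0.
  have nx : natpow n.+1 (rc x) != 0 by exact: natpow_neq0.
  have rcV (y y' : R) : rc (y / y') = rc y / rc y' by rewrite rmorphM fmorphV.
  have rcP N : rc (\prod_(1 <= j < N.+1) f j) = \prod_(j < N) rc (f j.+1).
    by rewrite rmorph_prod big_add1 /= big_mkord.
  rewrite rcV rcP -natpow_real.
  under eq_bigr do rewrite fE; rewrite prodf_div.
  apply: (mulfI nt); rewrite [RHS]prod_Gamma_seq//.
  transitivity (\prod_(j < n.+2) \prod_(l < k) (lam l + j%:R) *
    \prod_(l < k) Gamma_seq (lam l) n.+1 / natpow n.+1 (rc x)).
    by field; rewrite nx nt.
  rewrite prod_Gamma_seq// -mulrA; congr (_ * _).
  rewrite -[X in natpow _ X / _](subrK (\sum_(l < k) t l)) -xE natpowD mulrC mulKf//.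
have gL : \prod_(l < k) Gamma (lam l) != 0.
  by apply/prodf_neq0 => l _; exact: (gl l).2.
rewrite prodf_div; apply: (mulIf gL); rewrite divfK//.
apply: (@ccvg_unique _ (fun n => \prod_(l < k) Gamma_seq (t l) n)); last first.
  by apply: ccvg_prod => l; exact: (gt l).1.
apply: ccvgS; apply: eq_ccvg (key) _.
have LG : ccvg (fun n => \prod_(l < k) Gamma_seq (lam l) n) (\prod_(l < k) Gamma (lam l)).
  by apply: ccvg_prod => l; exact: (gl l).1.
exact: ccvgM (ccvg_shift cc') (ccvg_shift LG).
Qed.

End gamma_product.

(** * Sums over compositions and over decreasing chains *)

Section lists.

Lemma uniq_tuple_map n l : injective (fun t : l.-tuple 'I_n.+1 => [seq val x | x <- t]).
Proof. by move=> t t' /(inj_map val_inj)/val_inj. Qed.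

Lemma sum_ord_tuples (V : nmodType) n l (P : pred (seq nat)) (F : seq nat -> V)
    (L : seq (seq nat)) :
  uniq L -> (forall x, (x \in L) = [&& size x == l, all (gtn n.+1) x & P x]) ->
  \sum_(t : l.-tuple 'I_n.+1 | P [seq val x | x <- t]) F [seq val x | x <- t] =
  \sum_(x <- L) F x.
Proof.
move=> uL memL; rewrite -big_filter -(big_map _ xpredT F).
apply: perm_big; apply: uniq_perm => //.
  by rewrite map_inj_uniq ?filter_uniq ?index_enum_uniq//; exact: uniq_tuple_map.
move=> x; rewrite memL; apply/mapP/and3P.
  move=> [t]; rewrite mem_filter => /andP[Pt _] ->; split => //.
    by rewrite size_map size_tuple.
  by apply/allP => _ /mapP[i _ ->] /=.
move=> [/eqP sx ax Px].
have sx' : size [seq inord i : 'I_n.+1 | i <- x] == l by rewrite size_map sx.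
have xE : x = [seq val i | i <- Tuple sx'].
  rewrite /= -map_comp -[LHS]map_id; apply/eq_in_map => i ix /=.
  by rewrite inordK//; exact: (allP ax).
by exists (Tuple sx') => //; rewrite mem_filter -xE Px mem_index_enum.
Qed.

(** The recursion is on the excluded upper bound N, which makes the step from n
    to n+1 of chain sums a computation. *)
Fixpoint chains (lo N l : nat) : seq (seq nat) :=
  match l, N with
  | 0, _ => [:: [::]]
  | _.+1, 0 => [::]
  | l'.+1, N'.+1 => chains lo N' l ++
      if (lo <= N')%N then [seq N' :: x | x <- chains lo N' l'] else [::]
  end.

Lemma gtn_trans : transitive gtn.
Proof. by move=> a b c ba /(fun ac => ltn_trans ac ba). Qed.

Lemma mem_chains lo N l x : (x \in chains lo N l) =
  [&& size x == l, all (gtn N) x & sorted gtn x && all (leq lo) x].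
Proof.
elim: N l x => [|N IH] [|l] x.
- by case: x.
- by case: x => [|i x] //=; rewrite !andbF.
- by case: x.
rewrite /= mem_cat IH; case: x => [|i x].
  by rewrite (_ : _ \in _ = false)//; case: ifP => // _; apply/mapP => -[].
have mem_cons : (i :: x \in if (lo <= N)%N then [seq N :: x0 | x0 <- chains lo N l] else [::]) =
    [&& (lo <= N)%N, i == N & x \in chains lo N l].
  case: ifP => //= _; apply/mapP/andP => [[y yc [-> ->]]|[/eqP -> xc]].
    by rewrite eqxx.
  by exists x.
rewrite mem_cons IH /= eqSS !(path_sortedE gtn_trans).
have gtn_mono M M' : (M <= M')%N -> all (gtn M) x -> all (gtn M') x.
  by move=> MM; apply: sub_all => y /= yM; exact: leq_trans yM MM.
apply/idP/idP.
  move=> /orP[/and5P[-> /andP[iN aN] -> -> ->]|].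
    by rewrite ltnS (ltnW iN) (gtn_mono N).
  move=> /and5P[loN /eqP -> -> aN /andP[-> ->]].
  by rewrite ltnS leqnn aN loN (gtn_mono N).
move=> /and5P[-> /andP[iN _] /andP[ai ->] loi ->].
rewrite ltnS leq_eqVlt in iN; case/orP: iN => [/eqP iN|iN].
  by rewrite -iN loi eqxx ai orbT.
by rewrite iN ai loi (gtn_mono i)// ltnW.
Qed.

Lemma uniq_chains lo N l : uniq (chains lo N l).
Proof.
elim: N l => [|N IH] [|l] //=; rewrite cat_uniq IH /=.
case: ifP => // _; rewrite map_inj_uniq ?IH ?andbT; last by move=> x y [].
apply/hasPn => _ /mapP[x _ ->]; rewrite mem_chains /= ltnn /=.
by rewrite andbF.
Qed.

Fixpoint comps (l t : nat) : seq (seq nat) :=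
  match l with
  | 0 => if t == 0 then [:: [::]] else [::]
  | l'.+1 => [seq x :: h | x <- iota 1 t, h <- comps l' (t - x)]
  end.

Lemma mem_comps l t h : (h \in comps l t) = composition l t h.
Proof.
rewrite /composition; elim: l t h => [|l IH] t h.
  by rewrite /=; case: t h => [|t] [|x h].
apply/allpairsPdep/and3P => [[x [y [xt yt ->]]]|[]].
  move: xt yt; rewrite mem_iota IH => /andP[x1 xt] /and3P[sy ay ty] /=.
  rewrite eqSS sy x1 ay; split => //.
  by rewrite (eqP ty) subnKC//; move: xt; rewrite add1n ltnS.
case: h => [//|x y] /=; rewrite eqSS => sy /andP[x1 ay] /eqP st.
exists x, y; split => //; first by rewrite mem_iota x1 add1n ltnS -st leq_addr.
by rewrite IH sy ay -st addKn eqxx.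
Qed.

Lemma uniq_comps l t : uniq (comps l t).
Proof.
elim: l t => [|l IH] t /=; first by case: ifP.
apply: allpairs_uniq_dep; rewrite ?iota_uniq//.
by move=> [x y] [x' y'] _ _ /= [-> ->].
Qed.

End lists.

Section sums.
Variable R : realType.
Implicit Types (F : seq nat -> R) (h i : seq nat).

Lemma chain_sumE lo n l F : chain_sum lo n l F = \sum_(i <- chains lo n.+1 l) F i.
Proof.
apply: (@sum_ord_tuples _ n l (fun x => sorted gtn x && all (leq lo) x)).
  exact: uniq_chains.
by move=> x; rewrite mem_chains.
Qed.

Lemma comp_sumE l t F : comp_sum l t F = \sum_(h <- comps l t) F h.
Proof.
apply: sum_ord_tuples; first exact: uniq_comps.
move=> h; rewrite mem_comps /composition.
case: (size h == l) => //=; case: (all (leq 1) h) => /=; last by rewrite andbF.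
case: eqP => [<-|_]; last by rewrite andbF.
rewrite andbT; apply/esym/allP => x xh /=; rewrite ltnS.
by rewrite sumnE (big_rem x)//= leq_addr.
Qed.

Lemma chain_sum0 lo n F : chain_sum lo n 0 F = F [::].
Proof. by rewrite chain_sumE /= big_seq1. Qed.

(** Pascal recursion: the largest entry of a chain bounded by n+1 is n+1 or not. *)
Lemma chain_sumS lo n l F : chain_sum lo n.+1 l.+1 F =
  chain_sum lo n l.+1 F +
  (if (lo <= n.+1)%N then chain_sum lo n l (fun i => F (n.+1 :: i)) else 0).
Proof.
rewrite !chain_sumE [chains lo n.+2 _]/= big_cat /=; congr (_ + _).
by case: ifP => _; rewrite ?big_nil// big_map.
Qed.

Lemma chain_sum_small lo n l F : (n < lo)%N -> chain_sum lo n l.+1 F = 0.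
Proof.
rewrite chain_sumE => nlo; rewrite big_seq big1// => i.
rewrite mem_chains => /and3P[]; case: i => //= x i _ /andP[xn _] /and3P[_ lox _].
by have := leq_trans nlo lox; rewrite ltnNge -ltnS xn.
Qed.

Lemma eq_chain_sum lo n l F F' :
  (forall i, size i = l -> sorted gtn i -> all (leq lo) i -> all (geq n) i -> F i = F' i) ->
  chain_sum lo n l F = chain_sum lo n l F'.
Proof.
move=> FF; rewrite !chain_sumE; apply: eq_big_seq => i.
by rewrite mem_chains => /and3P[/eqP si ai /andP[so lo_i]]; exact: FF.
Qed.

Lemma chain_sumZ lo n l F (c : R) :
  chain_sum lo n l (fun i => c * F i) = c * chain_sum lo n l F.
Proof. by rewrite !chain_sumE mulr_sumr. Qed.

Lemma chain_sum_ge0 lo n l F : (forall i, 0 <= F i) -> 0 <= chain_sum lo n l F.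
Proof. by move=> F0; rewrite chain_sumE sumr_ge0. Qed.

Lemma norm_chain_sum_le lo n l F :
  `|chain_sum lo n l F| <= chain_sum lo n l (fun i => `|F i|).
Proof. by rewrite !chain_sumE; exact: ler_norm_sum. Qed.

Lemma chain_sum_increment lo l F n :
  `|chain_sum lo n.+1 l F - chain_sum lo n l F| <=
  chain_sum lo n.+1 l (fun i => `|F i|) - chain_sum lo n l (fun i => `|F i|).
Proof.
case: l => [|l]; first by rewrite !chain_sum0 !subrr normr0.
rewrite !chain_sumS ![_ + (if _ then _ else _)]addrC !addrK.
by case: ifP => _; rewrite ?normr0// norm_chain_sum_le.
Qed.

Lemma chain_summable_cvg lo l F : chain_summable lo l F ->
  (fun n => chain_sum lo n l F) @ \oo --> chain_series lo l F.
Proof. by move=> cF; apply: cvgn_le_increments cF; exact: chain_sum_increment. Qed.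

Lemma eq_comp_sum l t F F' : (forall h, composition l t h -> F h = F' h) ->
  comp_sum l t F = comp_sum l t F'.
Proof.
move=> FF; rewrite !comp_sumE; apply: eq_big_seq => h.
by rewrite mem_comps => /FF.
Qed.

Lemma comp_sum0 t F : comp_sum 0 t F = if t == 0%N then F [::] else 0.
Proof. by rewrite comp_sumE /=; case: ifP => _; rewrite ?big_seq1 ?big_nil. Qed.

Lemma comp_sumS l t F : comp_sum l.+1 t F =
  \sum_(1 <= x < t.+1) comp_sum l (t - x) (fun h => F (x :: h)).
Proof.
rewrite comp_sumE /= big_allpairs_dep /= /index_iota subn1.
by apply: eq_bigr => x _; rewrite comp_sumE.
Qed.

Lemma comp_sumD l t F F' :
  comp_sum l t (fun h => F h + F' h) = comp_sum l t F + comp_sum l t F'.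
Proof. by rewrite !comp_sumE big_split. Qed.

Lemma comp_sumZ l t F (c : R) : comp_sum l t (fun h => c * F h) = c * comp_sum l t F.
Proof. by rewrite !comp_sumE mulr_sumr. Qed.

Lemma comp_sum_small l t F : (t < l)%N -> comp_sum l t F = 0.
Proof.
elim: l t F => [//|l IH] t F tl; rewrite comp_sumS big_nat big1// => x /andP[x1 xt].
apply: IH; rewrite ltn_subLR//.
by apply: leq_trans tl _; rewrite -add1n leq_add2r.
Qed.

Lemma seq_sum_cvg (I : eqType) (s : seq I) (F : I -> nat -> R) (G : I -> R) :
  {in s, forall x, F x @ \oo --> G x} ->
  (fun n => \sum_(x <- s) F x n) @ \oo --> \sum_(x <- s) G x.
Proof.
elim: s => [_|h s IH Fs].
  rewrite big_nil [X in X @ _](_ : _ = (fun=> 0)); first exact: cvg_cst.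
  by apply/funext => n; rewrite big_nil.
rewrite big_cons [X in X @ _](_ : _ = (fun n => F h n + \sum_(x <- s) F x n)).
  apply: cvgD; first by apply: Fs; rewrite mem_head.
  by apply: IH => x xs; apply: Fs; rewrite inE xs orbT.
by apply/funext => n; rewrite big_cons.
Qed.

Lemma comp_sum_cvg l t (F : seq nat -> nat -> R) (G : seq nat -> R) :
  (forall h, composition l t h -> F h @ \oo --> G h) ->
  (fun n => comp_sum l t (F ^~ n)) @ \oo --> comp_sum l t G.
Proof.
move=> FG; under eq_fun do rewrite comp_sumE; rewrite comp_sumE.
by apply: seq_sum_cvg => h; rewrite mem_comps; exact: FG.
Qed.

Lemma sum_nat_cvg a c (F : nat -> nat -> R) (G : nat -> R) :
  (forall l, (a <= l < c)%N -> F l @ \oo --> G l) ->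
  (fun n => \sum_(a <= l < c) F l n) @ \oo --> \sum_(a <= l < c) G l.
Proof. by move=> FG; apply: seq_sum_cvg => l; rewrite mem_index_iota; exact: FG. Qed.

End sums.

(** * Weighted paths between levels *)

Section paths.
Variables (R : realType) (b : nat -> nat -> nat -> R).
Implicit Types (h i : seq nat).

(** A composition h and a chain i of the same length describe a path that starts
    from level p and goes back in time: h lists the heights of its jumps and i
    their times. The weight of a jump from level p to level q at time i is
    b i p q. *)
Fixpoint path_weight (p : nat) h i : R :=
  match h, i with
  | x :: h', y :: i' => b y p (p - x) * path_weight (p - x) h' i'
  | _, _ => 1
  end.

Definition paths lo n p k : R :=
  \sum_(0 <= l < (p - k).+1) comp_sum l (p - k) (fun h => chain_sum lo n l (path_weight p h)).

Definition paths_lim lo p k : R :=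
  \sum_(0 <= l < (p - k).+1)
    comp_sum l (p - k) (fun h => chain_series lo l (path_weight p h)).

Lemma paths_widen N lo n p k : (p - k < N)%N ->
  \sum_(0 <= l < N) comp_sum l (p - k) (fun h => chain_sum lo n l (path_weight p h)) =
  paths lo n p k.
Proof.
move=> pN; rewrite /paths (big_cat_nat (n := (p - k).+1))//=.
rewrite [X in _ + X]big_nat [X in _ + X]big1 ?addr0// => l /andP[pl _].
exact: comp_sum_small.
Qed.

Lemma paths_diag lo n k : paths lo n k k = 1.
Proof. by rewrite /paths subnn big_nat1 comp_sum0 /= chain_sum0. Qed.

Lemma paths_empty lo n p k : (n < lo)%N -> (k < p)%N -> paths lo n p k = 0.
Proof.
move=> nlo kp; rewrite /paths big_nat_recl// comp_sum0.
have -> : (p - k == 0)%N = false by rewrite subn_eq0 leqNgt kp.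
rewrite add0r big_nat big1// => l _.
rewrite comp_sumE big1// => h _.
exact: chain_sum_small.
Qed.

Lemma sum_nat_rev_sub k p (F : nat -> R) : (k <= p)%N ->
  \sum_(1 <= x < (p - k).+1) F (p - x)%N = \sum_(k <= q < p) F q.
Proof.
move=> kp; rewrite big_add1 /= [RHS]big_nat_rev /=.
rewrite (_ : \sum_(k <= i < p) _ = \sum_(0 + k <= i < p) F (k + p - i.+1)%N)//.
rewrite big_addn; apply: eq_bigr => x _; congr F.
by rewrite addnC -addSn subnDr.
Qed.

(** The jump at time n+1, if there is one, is the first jump of the path. *)
Lemma pathsS lo n p k : (lo <= n.+1)%N -> (k <= p)%N ->
  paths lo n.+1 p k = paths lo n p k +
    \sum_(k <= q < p) b n.+1 p q * paths lo n q k.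
Proof.
move=> lon kp; rewrite {1 2}/paths !big_nat_recl//.
rewrite ![comp_sum 0 _ _]comp_sum0 !chain_sum0 -addrA; congr (_ + _).
have step l h : chain_sum lo n.+1 l.+1 (path_weight p h) =
    chain_sum lo n l.+1 (path_weight p h) +
    chain_sum lo n l (fun i => path_weight p h (n.+1 :: i)).
  by rewrite chain_sumS lon.
under eq_bigr => l _ do under [comp_sum _ _ _]eq_comp_sum => h _ do rewrite step.
under eq_bigr => l _ do rewrite comp_sumD.
rewrite big_split /=; congr (_ + _).
under eq_bigr => l _ do rewrite comp_sumS.
rewrite exchange_big /= -(@sum_nat_rev_sub k p)//.
rewrite big_nat [RHS]big_nat; apply: eq_bigr => x /andP[x1 xpk].
rewrite -(@paths_widen (p - k)); last first.
  rewrite subnAC; move: xpk; rewrite ltnS; case: (p - k)%N x1 => [|m] x1 xm.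
    by move: (leq_trans x1 xm).
  by case: x x1 {xm} => // x _; rewrite subSS ltnS leq_subr.
rewrite mulr_sumr; apply: eq_bigr => l _; rewrite -comp_sumZ subnAC.
by apply: eq_comp_sum => h _; rewrite /= chain_sumZ.
Qed.

(** Paths from level p to level 0: the last jump, from level l at time k, is kept
    apart because the other jumps happen after time k, and because the sum over k
    is the outer series in the limit. *)
Definition paths0 n p : R :=
  \sum_(1 <= k < n.+1) \sum_(1 <= l < p.+1) b k l 0 * paths k.+1 n p l.

Lemma paths0S n p : (0 < p)%N ->
  paths0 n.+1 p = paths0 n p + b n.+1 p 0 + \sum_(1 <= q < p) b n.+1 p q * paths0 n q.
Proof.
move=> p0; rewrite {1}/paths0 big_nat_recr//=.
have -> : \sum_(1 <= l < p.+1) b n.+1 l 0 * paths n.+2 n.+1 p l = b n.+1 p 0.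
  rewrite big_nat_recr//= paths_diag mulr1 big_nat big1 ?add0r// => l /andP[_ lp].
  by rewrite paths_empty// mulr0.
rewrite addrAC; congr (_ + _).
have step k : (1 <= k < n.+1)%N -> \sum_(1 <= l < p.+1) b k l 0 * paths k.+1 n.+1 p l =
    \sum_(1 <= l < p.+1) b k l 0 * paths k.+1 n p l +
    \sum_(1 <= q < p) b n.+1 p q * \sum_(1 <= l < q.+1) b k l 0 * paths k.+1 n q l.
  move=> /andP[k1 kn].
  have lS l : (1 <= l < p.+1)%N -> b k l 0 * paths k.+1 n.+1 p l =
      b k l 0 * paths k.+1 n p l + \sum_(l <= q < p) b k l 0 * (b n.+1 p q * paths k.+1 n q l).
    by move=> /andP[l1 lp]; rewrite pathsS// mulrDr mulr_sumr.
  rewrite (eq_big_nat _ _ lS) big_split /=; congr (_ + _).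
  rewrite big_nat_recr//= [X in _ + X]big_geq// addr0.
  transitivity (\sum_(1 <= l < p) \sum_(1 <= q < p | (l <= q)%N)
      b k l 0 * (b n.+1 p q * paths k.+1 n q l)).
    rewrite big_nat [RHS]big_nat; apply: eq_bigr => l /andP[l1 lp].
    by rewrite (big_nat_widenl _ 1)//; apply: eq_bigl => q; rewrite andbT.
  rewrite (exchange_big_dep_nat xpredT)//=.
  rewrite big_nat [RHS]big_nat; apply: eq_bigr => q /andP[q1 qp].
  rewrite mulr_sumr [RHS](big_nat_widen _ _ p)//=.
  by apply: eq_big => [l|l _]; rewrite ?ltnS// mulrCA.
rewrite (eq_big_nat _ _ step) big_split /=; congr (_ + _).
rewrite exchange_big /=; apply: eq_bigr => q _.
by rewrite mulr_sumr.
Qed.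

End paths.

(** When the jump weights are dominated by a summable sequence of times, all the
    sums over chains converge absolutely, uniformly in the lower bound. *)
Section path_limits.
Variables (R : realType) (b : nat -> nat -> nat -> R).
Variables (beta : nat -> R) (s : nat) (B : R).
Hypothesis beta_ge0 : forall i, 0 <= beta i.
Hypothesis beta_sum : forall n, \sum_(1 <= i < n.+1) beta i <= B.
Hypothesis b_le : forall i p q, (1 <= i)%N -> (q < p <= s)%N -> `|b i p q| <= beta i.

Let Bs n := \sum_(1 <= i < n.+1) beta i.

Let BsS n : Bs n.+1 = Bs n + beta n.+1.
Proof. by rewrite /Bs big_nat_recr. Qed.

Let Bs_ge0 n : 0 <= Bs n.
Proof. exact: sumr_ge0. Qed.

Let B_ge0 : 0 <= B.
Proof. exact: le_trans (Bs_ge0 0) (beta_sum 0). Qed.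

Let Bs_cvg : cvgn Bs.
Proof.
by apply: (@nondecreasing_bounded_cvgn _ Bs B) => // n; rewrite BsS lerDl.
Qed.

(** A sum over decreasing chains is at most the product of independent sums. *)
Lemma path_weight_sum_le lo n l p h : (0 < lo)%N -> (p <= s)%N -> size h = l ->
  all (leq 1) h -> (sumn h <= p)%N ->
  chain_sum lo n l (fun i => `|path_weight b p h i|) <= Bs n ^+ l.
Proof.
move=> lo0; elim: n l p h => [|n IH] [|l] p [|x h]//= ps.
- by rewrite chain_sum0 normr1.
- by rewrite chain_sum_small// exprn_ge0.
- by rewrite chain_sum0 normr1.
move=> [sh] /andP[x1 ah] hp; rewrite chain_sumS.
have xp : (x <= p)%N by exact: leq_trans (leq_addr _ _) hp.
have h1 : chain_sum lo n l.+1 (fun i => `|path_weight b p (x :: h) i|) <= Bs n ^+ l.+1.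
  by apply: IH => //=; rewrite ?sh// x1.
have h2 : (if (lo <= n.+1)%N then chain_sum lo n l
    (fun i => `|path_weight b p (x :: h) (n.+1 :: i)|) else 0) <= beta n.+1 * Bs n ^+ l.
  case: ifP => _; last by rewrite mulr_ge0// exprn_ge0.
  rewrite /=; under [chain_sum _ _ _ _]eq_chain_sum => i _ _ _ _ do rewrite normrM.
  rewrite chain_sumZ ler_pM ?chain_sum_ge0//.
    by apply: b_le => //; rewrite ps andbT ltn_subrL x1 (leq_trans x1 xp).
  by apply: IH => //; [rewrite (leq_trans (leq_subr _ _))|rewrite leq_subRL].
apply: le_trans (lerD h1 h2) _; rewrite exprS -mulrDl BsS exprS.
by rewrite ler_wpM2l ?addr_ge0// lerXn2r ?nnegrE ?addr_ge0// lerDl.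
Qed.

Lemma path_summable lo l p h : (0 < lo)%N -> (p <= s)%N -> size h = l ->
  all (leq 1) h -> (sumn h <= p)%N -> chain_summable lo l (path_weight b p h).
Proof.
move=> lo0 ps sh ah hp.
apply: (@nondecreasing_bounded_cvgn _ _ (B ^+ l)) => n.
  case: l sh => [|l] sh; first by rewrite !chain_sum0.
  by rewrite chain_sumS lerDl; case: ifP => // _; exact: chain_sum_ge0.
apply: le_trans (path_weight_sum_le _ lo0 ps sh ah hp) _.
by rewrite lerXn2r ?nnegrE//; exact: beta_sum.
Qed.

Lemma paths_cvg lo p k : (0 < lo)%N -> (p <= s)%N ->
  (fun n => paths b lo n p k) @ \oo --> paths_lim b lo p k.
Proof.
move=> lo0 ps; apply: sum_nat_cvg => l _.
apply: comp_sum_cvg => h /and3P[/eqP sh ah /eqP hp].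
by apply: chain_summable_cvg; apply: path_summable; rewrite ?hp ?leq_subr.
Qed.

Let M := expR (s%:R * B).

(** By the recursion in n, time n multiplies the bound by at most
    1 + s beta_n <= exp (s beta_n). *)
Lemma paths_le lo n p k : (0 < lo)%N -> (k <= p)%N -> (p <= s)%N ->
  `|paths b lo n p k| <= expR (s%:R * Bs n).
Proof.
move=> lo0; elim: n p => [|n IH] p kp ps.
  have e1 : 1 <= expR (s%:R * Bs 0) by apply: le_trans (expR_ge1Dx _); rewrite lerDl mulr_ge0.
  move: kp; rewrite leq_eqVlt => /predU1P[<-|kp]; first by rewrite paths_diag normr1.
  by rewrite paths_empty// normr0 expR_ge0.
have [lon|nlo] := leqP lo n.+1; last first.
  have e1 : 1 <= expR (s%:R * Bs n.+1) by apply: le_trans (expR_ge1Dx _); rewrite lerDl mulr_ge0.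
  move: kp; rewrite leq_eqVlt => /predU1P[<-|kp]; first by rewrite paths_diag normr1.
  by rewrite paths_empty// normr0 expR_ge0.
rewrite pathsS//; apply: le_trans (ler_normD _ _) _.
set E := expR (s%:R * Bs n) in IH *.
have E0 : 0 <= E by exact: expR_ge0.
apply: (@le_trans _ _ (E + s%:R * (beta n.+1 * E))).
  rewrite lerD ?IH//; apply: le_trans (ler_norm_sum _ _ _) _.
  apply: (@le_trans _ _ (\sum_(k <= q < p) beta n.+1 * E)).
    rewrite !big_nat; apply: ler_sum => q /andP[kq qp]; rewrite normrM ler_pM//.
      by rewrite b_le// qp.
    by rewrite IH// (leq_trans (ltnW qp)).
  rewrite sumr_const_nat -[leLHS]mulr_natl ler_wpM2r ?mulr_ge0// ler_nat.
  by rewrite (leq_trans (leq_subr _ _)).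
rewrite BsS mulrDr expRD -/E mulrA -{1}(mulr1 E) [X in _ + X]mulrC -mulrDr ler_wpM2l//.
exact: expR_ge1Dx.
Qed.

Lemma paths_leM lo n p k : (0 < lo)%N -> (k <= p)%N -> (p <= s)%N ->
  `|paths b lo n p k| <= M.
Proof.
move=> lo0 kp ps; apply: le_trans (paths_le _ lo0 kp ps) _.
by rewrite ler_expR ler_wpM2l ?ler0n// beta_sum.
Qed.

Let paths_increment lo p k : (0 < lo)%N -> (k <= p)%N -> (p <= s)%N ->
  forall n, `|paths b lo n.+1 p k - paths b lo n p k| <=
    s%:R * M * Bs n.+1 - s%:R * M * Bs n.
Proof.
move=> lo0 kp ps n; have M0 : 0 <= M by exact: expR_ge0.
have pos : 0 <= s%:R * M * beta n.+1 by rewrite !mulr_ge0.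
rewrite -mulrBr BsS addrAC subrr add0r.
have [lon|nlo] := leqP lo n.+1; last first.
  move: kp; rewrite leq_eqVlt => /predU1P[<-|kp]; first by rewrite !paths_diag subrr normr0.
  by rewrite !paths_empty ?subrr ?normr0// ltnW.
rewrite pathsS// addrAC subrr add0r; apply: le_trans (ler_norm_sum _ _ _) _.
apply: (@le_trans _ _ (\sum_(k <= q < p) beta n.+1 * M)).
  rewrite !big_nat; apply: ler_sum => q /andP[kq qp]; rewrite normrM ler_pM//.
    by rewrite b_le// qp.
  by rewrite paths_leM// (leq_trans (ltnW qp)).
rewrite sumr_const_nat -[leLHS]mulr_natl -mulrA [M * _]mulrC ler_wpM2r ?mulr_ge0// ler_nat.
by rewrite (leq_trans (leq_subr _ _)).
Qed.

Let sM_cvg : cvgn (fun n => s%:R * M * Bs n).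
Proof. exact: is_cvgMr. Qed.

Lemma paths_lim_tail lo n p k : (0 < lo)%N -> (k <= p)%N -> (p <= s)%N ->
  `|paths_lim b lo p k - paths b lo n p k| <= s%:R * M * (limn Bs - Bs n).
Proof.
move=> lo0 kp ps.
have := limn_le_increments (paths_increment lo0 kp ps) sM_cvg n.
rewrite (cvg_lim _ (paths_cvg (k := k) lo0 ps))//.
by rewrite limM//; [rewrite lim_cst// mulrBr|exact: is_cvg_cst].
Qed.

Lemma paths_lim_le lo p k : (0 < lo)%N -> (k <= p)%N -> (p <= s)%N ->
  `|paths_lim b lo p k| <= M.
Proof.
move=> lo0 kp ps.
rewrite -(cvg_lim _ (cvg_norm (paths_cvg (k := k) lo0 ps)))//.
apply: limr_le; first by apply: cvgP; exact: cvg_norm (paths_cvg lo0 ps).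
by apply: nearW => n; exact: paths_leM.
Qed.

Definition last_jump_series N : R :=
  \sum_(1 <= k < N.+1) \sum_(1 <= l < s.+1) b k l 0 * paths_lim b k.+1 s l.

(** The tail bound is uniform in the time k of the last jump, so that the chains
    may be completed to infinity under the sum over k. *)
Lemma paths0_cvg : exists L : R,
  last_jump_series @ \oo --> L /\ (fun n => paths0 b n s) @ \oo --> L.
Proof.
have M0 : 0 <= M by exact: expR_ge0.
have bk k l : (1 <= k)%N -> (1 <= l < s.+1)%N -> `|b k l 0| <= beta k.
  by move=> k1 /andP[l1 ls]; rewrite b_le// l1.
have cS : cvgn last_jump_series.
  apply: (@cvgn_le_increments _ _ (fun n => s%:R * M * Bs n)) => // n.
  rewrite /last_jump_series big_nat_recr//= addrAC subrr add0r -mulrBr BsS.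
  rewrite addrAC subrr add0r; apply: le_trans (ler_norm_sum _ _ _) _.
  apply: (@le_trans _ _ (\sum_(1 <= l < s.+1) beta n.+1 * M)).
    rewrite !big_nat; apply: ler_sum => l ls; rewrite normrM ler_pM ?bk//.
    by rewrite paths_lim_le//; case/andP: ls.
  by rewrite sumr_const_nat subn1 /= -[leLHS]mulr_natl -mulrA [M * _]mulrC.
exists (limn last_jump_series); split => //.
rewrite -[X in _ --> X]addr0.
rewrite [X in X @ _](_ : _ = (fun n => last_jump_series n
  + (paths0 b n s - last_jump_series n))); last first.
  by apply/funext => n; rewrite addrC subrK.
apply: cvgD => //.
pose K := B * (s%:R * (s%:R * M)).
have tail0 : (fun n => K * (limn Bs - Bs n)) @ \oo --> (0 : R).
  rewrite -[X in _ --> X](mulr0 K); apply: cvgMr.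
  by rewrite -[X in _ --> X](subrr (limn Bs)); apply: cvgB => //; exact: cvg_cst.
have dom n : `|paths0 b n s - last_jump_series n| <= K * (limn Bs - Bs n).
  have t0 : 0 <= limn Bs - Bs n.
    rewrite subr_ge0; apply: nondecreasing_cvgn_le => //.
    by apply/nondecreasing_seqP => i; rewrite BsS lerDl.
  rewrite /paths0 /last_jump_series -sumrB; apply: le_trans (ler_norm_sum _ _ _) _.
  apply: (@le_trans _ _ (\sum_(1 <= k < n.+1) beta k * (s%:R * (s%:R * M * (limn Bs - Bs n))))).
    rewrite !big_nat; apply: ler_sum => k /andP[k1 _].
    rewrite -sumrB; apply: le_trans (ler_norm_sum _ _ _) _.
    apply: (@le_trans _ _ (\sum_(1 <= l < s.+1) beta k * (s%:R * M * (limn Bs - Bs n)))).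
      rewrite !big_nat; apply: ler_sum => l ls; rewrite -mulrBr normrM ler_pM ?bk//.
      by rewrite distrC paths_lim_tail//; case/andP: ls.
    by rewrite sumr_const_nat subn1 /= -[leLHS]mulr_natl mulrCA.
  rewrite -mulr_suml -!mulrA; apply: ler_wpM2r; last exact: beta_sum.
  by rewrite !mulr_ge0.
apply: (squeeze_cvgr (f := fun n : nat => - (K * (limn Bs - Bs n)))
     (h := fun n : nat => K * (limn Bs - Bs n))) => //.
  by near=> n; rewrite -ler_norml.
by rewrite -[X in _ --> X]oppr0; exact: cvgN.
Unshelve. all: by end_near. Qed.

End path_limits.

(** * Chain products as weighted paths *)

Section chain_products.
Variables (R : realType) (u : urn).
Local Notation f := (fcoef R u).

#[local] Arguments fcoef : simpl never.

Definition diag_prod p n : R := \prod_(1 <= j < n.+1) f j p p.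

(** Dividing by the diagonal products turns the factors along a chain into a
    product of one weight per jump: between two jumps nothing is left. *)
Definition jump i p q : R := f i p q * diag_prod q i.-1 / diag_prod p i.

Lemma fcoef00 n : f n 0 0 = 1.
Proof.
case: n => [//|n]; rewrite /fcoef /= !big_nat1 /=.
rewrite !(expr0, bin0, mul1r, mulr1, divr1, invr1) /pcoef.
case: (model u); last by rewrite !(expr0, mulr1, invr1).
by rewrite min0n big_nat1 !bin0 !(expr0, mulr1, invr1).
Qed.

Lemma diag_prod0 n : diag_prod 0 n = 1.
Proof. by rewrite /diag_prod big1// => j _; exact: fcoef00. Qed.

Hypothesis f_neq0 : forall n p, f n p p != 0.

Lemma diag_prod_neq0 p n : diag_prod p n != 0.
Proof.
by rewrite /diag_prod; elim/big_ind: _ => // [x y]; exact: mulf_neq0.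
Qed.

Lemma diag_prodS p n : diag_prod p n.+1 = diag_prod p n * f n.+1 p p.
Proof. by rewrite /diag_prod big_nat_recr. Qed.

Lemma diag_prod_split p y n : (y <= n)%N ->
  \prod_(y.+1 <= j < n.+1) f j p p = diag_prod p n / diag_prod p y.
Proof.
move=> yn; apply: (canRL (mulfK (diag_prod_neq0 p y))); rewrite mulrC.
by rewrite /diag_prod -big_cat_nat.
Qed.

Lemma phi_term_cons n s x h y i last : (0 < y)%N ->
  phi_term R u n s (x :: h) (y :: i) last =
  f y s (s - x) * \prod_(y.+1 <= j < n.+1) f j s s *
  phi_term R u y.-1 (s - x) h i last.
Proof.
move=> y0; rewrite /phi_term big_ltn// big_add1 /=; congr (_ * _).
  by rewrite /chain_factor /level /= take0 !subn0 addn0.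
rewrite [LHS]big_nat [RHS]big_nat; apply: eq_bigr => -[//|g] _.
by rewrite /chain_factor /level /= !subnDA prednK.
Qed.

Lemma phi_term_path n s h i : size h = size i -> sorted gtn i ->
  all (leq 1) i -> all (geq n) i ->
  phi_term R u n s h i 0 = diag_prod s n * path_weight jump s h i.
Proof.
elim: i n s h => [|y i IH] n s [|x h]//=.
  by move=> _ _ _ _; rewrite /phi_term big_nat1 /chain_factor /level /= !subn0 mul1r mulr1.
move=> [sh] si /andP[y0 ai] /andP[yn _].
have [yi si'] : all (gtn y) i /\ sorted gtn i.
  by apply/andP; rewrite -(path_sortedE gtn_trans).
rewrite phi_term_cons// IH//; last first.
  by apply: sub_all yi => z /=; rewrite -{1}(prednK y0) ltnS.
rewrite diag_prod_split// /jump; field.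
by rewrite diag_prod_neq0.
Qed.

Lemma phi_term_path0 n s h i l k : size h = size i -> sorted gtn i ->
  all (leq k.+1) i -> all (geq n) i -> (k <= n)%N -> s = (sumn h + l)%N ->
  phi_term R u n s (rcons h l) i k =
  diag_prod s n * (path_weight jump s h i * jump k l 0).
Proof.
elim: i n s h => [|y i IH] n s [|x h]//=.
  move=> _ _ _ _ kn ->; rewrite /phi_term big_nat1 /chain_factor /level /=.
  rewrite addn0 subnn subn0 add0n diag_prod_split// /jump mul1r.
  by rewrite diag_prod0 mulr1 mulrCA mulrA.
move=> [sh] si /andP[y0 ai] /andP[yn _] kn sE.
have [yi si'] : all (gtn y) i /\ sorted gtn i.
  by apply/andP; rewrite -(path_sortedE gtn_trans).
have y1 : (0 < y)%N by exact: leq_ltn_trans y0.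
rewrite phi_term_cons// IH//; first last.
- by rewrite sE -addnA addKn.
- by rewrite -ltnS prednK.
- by apply: sub_all yi => z /=; rewrite -{1}(prednK y1) ltnS.
rewrite diag_prod_split// /jump; field.
by rewrite !diag_prod_neq0.
Qed.

(** The truncated terms are the terms of the series up to a factor that is common
    to all of them: the limits of the quotients are the sums of the series. *)
Lemma tphi_term_phi_term n s h i last : (head last i <= n)%N ->
  phi_term R u n s h i last = diag_prod s n * tphi_term R u s h i last.
Proof.
move=> yn; rewrite /phi_term /tphi_term big_ltn//.
have Ey : nth 0%N (rcons i last) 0 = head last i by case: i {yn}.
rewrite {1}/chain_factor /= Ey diag_prod_split// (_ : level s h 0 = s); last first.
  by rewrite /level take0 subn0.
rewrite (_ : \prod_(2 <= g < (size i).+2) chain_factor R u s h (nth 0%N (n.+1 :: rcons i last)) g =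
  \prod_(2 <= g < (size i).+2) chain_factor R u s h (nth 0%N (0%N :: rcons i last)) g); last first.
  by rewrite [LHS]big_nat [RHS]big_nat; apply: eq_bigr => -[|[|g]].
rewrite -/(diag_prod s (head last i)); field; exact: diag_prod_neq0.
Qed.

Lemma tphi_term_path s h i : size h = size i -> sorted gtn i ->
  all (leq 1) i -> tphi_term R u s h i 0 = path_weight jump s h i.
Proof.
move=> sh si ai; apply: (mulfI (diag_prod_neq0 s (head 0%N i))).
rewrite -tphi_term_phi_term// phi_term_path//.
case: i si {sh ai} => //= y i; rewrite (path_sortedE gtn_trans) leqnn /= => /andP[yi _].
by apply: sub_all yi => z /= /ltnW.
Qed.

Lemma tphi_term_path0 s h i l k : size h = size i -> sorted gtn i ->
  all (leq k.+1) i -> s = (sumn h + l)%N ->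
  tphi_term R u s (rcons h l) i k = path_weight jump s h i * jump k l 0.
Proof.
move=> sh si ai sE; apply: (mulfI (diag_prod_neq0 s (head k i))).
rewrite -tphi_term_phi_term// phi_term_path0//.
- case: i si {sh ai} => //= y i; rewrite (path_sortedE gtn_trans) leqnn /= => /andP[yi _].
  by apply: sub_all yi => z /= /ltnW.
- by case: i ai {sh si} => //= y i /andP[/ltnW].
Qed.

Lemma phi_paths n s k : (1 <= k <= s)%N ->
  phi R u n s k = diag_prod s n * paths jump 1 n s k.
Proof.
move=> /andP[k1 ks]; rewrite /phi k1; case: eqP => [->|/eqP kns].
  by rewrite paths_diag mulr1.
have kls : (k < s)%N by rewrite ltn_neqAle kns.
rewrite /paths [in RHS]big_nat_recl// comp_sum0 subn_eq0 leqNgt kls /= add0r big_add1 /=.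
rewrite mulr_sumr; apply: eq_bigr => l _; rewrite -comp_sumZ.
apply: eq_comp_sum => h /and3P[/eqP sh _ _]; rewrite -chain_sumZ.
by apply: eq_chain_sum => i si so ai an; rewrite phi_term_path// sh si.
Qed.

Lemma phi0_paths n s : (1 <= s)%N ->
  phi R u n s 0 = diag_prod s n * paths0 jump n s.
Proof.
move=> s1; rewrite /phi (ltn_eqF s1) /= /paths0 mulr_sumr [LHS]big_nat [RHS]big_nat.
apply: eq_bigr => k /andP[k1 kn]; rewrite mulr_sumr [LHS]big_nat [RHS]big_nat.
apply: eq_bigr => l /andP[l1 ls]; rewrite mulrA /paths mulr_sumr.
rewrite [LHS]big_nat [RHS]big_nat; apply: eq_bigr => r /andP[_ rs].
rewrite -!comp_sumZ; apply: eq_comp_sum => h /and3P[/eqP sh _ /eqP hE].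
rewrite -!chain_sumZ; apply: eq_chain_sum => i si so ai an.
rewrite phi_term_path0 ?sh ?si ?hE ?subnK//; first by ring.
Qed.

(** A path is decomposed by its step at time n+1, which leads from level s to some
    level r; the moments satisfy the same recursion. *)
Lemma phi_recursion n s k : (1 <= k <= s)%N ->
  phi R u n.+1 s k = \sum_(k <= r < s.+1) f n.+1 s r * phi R u n r k.
Proof.
move=> /andP[k1 ks]; rewrite phi_paths ?k1// pathsS// mulrDr.
rewrite big_nat_recr//= [in RHS]addrC phi_paths ?k1// diag_prodS.
congr (_ + _); first by ring.
rewrite [LHS]mulr_sumr [LHS]big_nat [RHS]big_nat; apply: eq_bigr => q /andP[kq qs].
rewrite phi_paths ?k1// /jump /= -diag_prodS; field.
exact: diag_prod_neq0.
Qed.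

(** At k = 0 the sum also runs over level 0, where the path rests: this yields
    the jumps to level 0 at time n+1. *)
Lemma phi_recursion0 n s : (1 <= s)%N ->
  phi R u n.+1 s 0 = \sum_(0 <= r < s.+1) f n.+1 s r * phi R u n r 0.
Proof.
move=> s1; rewrite phi0_paths// paths0S// !mulrDr.
rewrite [RHS]big_nat_recr//= [in RHS]big_ltn// [phi R u n s 0]phi0_paths// diag_prodS.
rewrite [LHS]addrAC [RHS]addrC [in RHS](addrC (f n.+1 s 0 * _)) [RHS]addrA.
congr (_ + _ + _); first by ring.
  rewrite [LHS]mulr_sumr [LHS]big_nat [RHS]big_nat.
  apply: eq_bigr => q /andP[kq qs].
  rewrite phi0_paths// /jump /= -diag_prodS; field.
  exact: diag_prod_neq0.
rewrite /phi eqxx -/(diag_prod 0 n) /jump /= -diag_prodS; field.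
exact: diag_prod_neq0.
Qed.

End chain_products.

(** * Decay of real sequences *)

Section decay.
Variable R : realType.
Implicit Types (e : nat -> R).

Definition decays k e := exists K : R, forall n, `|e n| <= K / n.+1%:R ^+ k.

Lemma decays_ge0 k e : decays k e ->
  exists2 K : R, 0 <= K & forall n, `|e n| <= K / n.+1%:R ^+ k.
Proof.
case=> K hK; exists K => //; have := hK 0%N.
by rewrite expr1n divr1; exact: le_trans.
Qed.

Lemma eq_decays k e e' : (forall n, e n = e' n) -> decays k e -> decays k e'.
Proof. by move=> ee; rewrite (_ : e = e')//; exact/funext. Qed.

Lemma decays_cst (c : R) : decays 0 (fun=> c).
Proof. by exists `|c| => n; rewrite expr0 divr1. Qed.

Lemma decays_inv k : decays k (fun n => (n.+1%:R ^+ k)^-1).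
Proof. by exists 1 => n; rewrite mul1r ger0_norm// invr_ge0 exprn_ge0. Qed.

Lemma decaysD k e e' : decays k e -> decays k e' -> decays k (fun n => e n + e' n).
Proof.
move=> [K hK] [K' hK']; exists (K + K') => n; rewrite mulrDl.
by apply: le_trans (ler_normD _ _) (lerD _ _).
Qed.

Lemma decaysM k k' e e' : decays k e -> decays k' e' ->
  decays (k + k') (fun n => e n * e' n).
Proof.
move=> [K hK] [K' hK']; exists (K * K') => n.
by rewrite normrM exprD invfM mulrACA ler_pM.
Qed.

Lemma decaysZ k (c : R) e : decays k e -> decays k (fun n => c * e n).
Proof. by move=> ek; rewrite -(add0n k); exact: decaysM (decays_cst c) ek. Qed.

Lemma decaysW k k' e : (k' <= k)%N -> decays k e -> decays k' e.
Proof.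
move=> kk /decays_ge0[K K0 hK]; exists K => n; apply: le_trans (hK n) _.
rewrite ler_wpM2l// lef_pV2 ?posrE ?exprn_gt0//.
by rewrite -!natrX ler_nat leq_pexp2l.
Qed.

Lemma decaysS k e : decays k e -> decays k (fun n => e n.+1).
Proof.
move=> /decays_ge0[K K0 hK]; exists K => n; apply: le_trans (hK n.+1) _.
rewrite ler_wpM2l// lef_pV2 ?posrE ?exprn_gt0//.
by rewrite lerXn2r ?nnegrE// ler_nat.
Qed.

Lemma decays_sum (I : eqType) (s : seq I) (P : pred I) k (e : I -> nat -> R) :
  {in s, forall i, P i -> decays k (e i)} ->
  decays k (fun n => \sum_(i <- s | P i) e i n).
Proof.
elim: s => [|i s IH] es.
  by exists 0 => n; rewrite big_nil normr0 mul0r.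
have es' : decays k (fun n => \sum_(i <- s | P i) e i n).
  by apply: IH => j js; apply: es; rewrite inE js orbT.
case Pi : (P i); last first.
  by apply: eq_decays es' => n; rewrite big_cons Pi.
have ei : decays k (e i) by apply: es; rewrite ?mem_head.
by apply: eq_decays (decaysD ei es') => n; rewrite big_cons Pi.
Qed.

Lemma decays_sum_nat a c k (e : nat -> nat -> R) :
  (forall i, (a <= i < c)%N -> decays k (e i)) ->
  decays k (fun n => \sum_(a <= i < c) e i n).
Proof. by move=> h; apply: decays_sum => i; rewrite mem_index_iota => /h. Qed.

Lemma decays_growth k j (c : R) e : (j <= k)%N -> decays k e ->
  decays (k - j) (fun n => (c * n%:R) ^+ j * e n).
Proof.
move=> jk /decays_ge0[K K0 hK]; exists (`|c| ^+ j * K) => n.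
have x0 : n.+1%:R != 0 :> R by rewrite pnatr_eq0.
rewrite normrM normrX normrM exprMn.
have -> : `|c| ^+ j * K / n.+1%:R ^+ (k - j) = `|c| ^+ j * n.+1%:R ^+ j * (K / n.+1%:R ^+ k).
  rewrite -{2}(subnK jk) exprD; move: (n.+1%:R : R) x0 => x x0.
  by field; rewrite !expf_neq0.
rewrite ler_pM// ?mulr_ge0 ?exprn_ge0// ler_wpM2l ?exprn_ge0//.
by rewrite normr_nat lerXn2r ?nnegrE ?ler_nat.
Qed.

End decay.

(** * Size of the coefficients *)

Section coefficient_bounds.
Variables (R : realType) (u : urn).
Hypothesis (hm : (1 <= ssize u)%N) (hsigma : (1 <= sigma u)%N).
Hypothesis hT0 : (ssize u <= total_balls u 0)%N.
Hypothesis hLambda : 2^-1 < Lambda R u < 1.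
Local Notation f := (fcoef R u).
Local Notation m := (ssize u).
Local Notation T := (total_balls u).
Local Notation L := (Lambda R u).

Let L_gt0 : 0 < L. Proof. by have /andP[+ _] := hLambda; apply: lt_trans; rewrite invr_gt0. Qed.

Lemma total_ballsE n : T n = (T 0 + sigma u * n)%N.
Proof. by rewrite /total_balls muln0 addn0. Qed.

Lemma total_balls_ge n : (m + n <= T n)%N.
Proof. by rewrite total_ballsE leq_add// leq_pmull. Qed.

(** The factorial moment of order j of the number of white balls in a sample is
    the j-th power of W_n, falling without replacement and ordinary with
    replacement, times this coefficient. *)
Definition unit_moment n j : R :=
  match model u with
  | without_replacement => 'C(m, j)%:R / 'C(T n, j)%:R
  | with_replacement => (m ^_ j)%:R / (T n)%:R ^+ j
  end.

Lemma unit_moment_small n j : (m < j)%N -> unit_moment n j = 0.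
Proof.
by move=> mj; rewrite /unit_moment; case: (model u); rewrite (bin_small, ffact_small)// mul0r.
Qed.

Lemma unit_moment0 n : unit_moment n 0 = 1.
Proof. by rewrite /unit_moment; case: (model u); rewrite ?bin0 ?ffactn0 ?expr0 divr1. Qed.

Lemma unit_moment1 n : unit_moment n 1 = m%:R / (T n)%:R.
Proof. by rewrite /unit_moment; case: (model u); rewrite ?bin1 ?ffactn1 ?expr1. Qed.

Lemma unit_moment_ge0 n j : 0 <= unit_moment n j.
Proof.
by rewrite /unit_moment; case: (model u); rewrite divr_ge0// exprn_ge0.
Qed.

Lemma ffact_ge n j t : (n + j <= t)%N -> (n.+1 ^ j <= t ^_ j)%N.
Proof.
elim: j => [//|j IH] njt; rewrite expnSr ffactnSr leq_mul//.
  by apply: IH; apply: leq_trans njt; rewrite leq_add2l.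
by rewrite ltn_subRL addnC -addnS.
Qed.

Lemma unit_moment_decay j : decays j (unit_moment^~ j).
Proof.
have [mj|jm] := ltnP m j.
  by exists 0 => n; rewrite unit_moment_small// normr0 mul0r.
exists (m ^_ j)%:R => n; rewrite ger0_norm ?unit_moment_ge0// /unit_moment.
have jT : (n + j <= T n)%N by rewrite addnC (leq_trans _ (total_balls_ge n))// leq_add2r.
have n0 : 0 < n.+1%:R ^+ j :> R by rewrite exprn_gt0.
have jf : (0 < j`!)%N by exact: fact_gt0.
case: (model u); last first.
  rewrite ler_wpM2l// lef_pV2 ?posrE ?exprn_gt0 ?ltr0n//; last first.
    by rewrite (leq_trans _ (total_balls_ge n))// addn_gt0 hm.
  rewrite -!natrX ler_nat; case: j {n0 jm jf jT} => // j.
  by rewrite leq_exp2r// (leq_trans _ (total_balls_ge n))// -add1n leq_add2r.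
rewrite -(bin_ffact m j) natrM -mulrA ler_wpM2l//.
have Cp : 0 < 'C(T n, j)%:R :> R.
  by rewrite ltr0n bin_gt0 (leq_trans _ jT)// leq_addl.
rewrite -[leLHS]mul1r ler_pdivrMr// mulrAC ler_pdivlMr// mul1r mulrC.
by rewrite -natrX -natrM ler_nat bin_ffact ffact_ge.
Qed.

Lemma stirling2_small n k : (n < k)%N -> stirling2 n k = 0%N.
Proof.
elim: n k => [|n IH] [|k]//= nk; rewrite !IH// ?muln0//.
exact: ltnW.
Qed.

Lemma stirling1_small n k : (n < k)%N -> stirling1 n k = 0%N.
Proof.
elim: n k => [|n IH] [|k]//= nk; rewrite !IH// ?muln0//.
exact: ltnW.
Qed.

Lemma stirling2_diag n : stirling2 n n = 1%N.
Proof. by elim: n => [//|n IH] /=; rewrite stirling2_small// muln0 IH. Qed.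

Lemma stirling1_diag n : stirling1 n n = 1%N.
Proof. by elim: n => [//|n IH] /=; rewrite stirling1_small// muln0 IH. Qed.

Lemma pcoef_diag n j : pcoef R u n j j = unit_moment n j.
Proof.
case: (ltnP m j) => [mj|jm].
  rewrite unit_moment_small// /pcoef; case: (model u).
    by rewrite big_geq// (minn_idPr (ltnW mj)).
  by rewrite ffact_small// mulr0 mul0r.
rewrite /pcoef /unit_moment; case: (model u).
  rewrite (minn_idPl jm) big_nat1 subnn expr0 stirling1_diag stirling2_diag.
  by rewrite !mul1r.
by rewrite stirling2_diag mul1r.
Qed.

Lemma pcoef_decay i l : decays l (fun n => pcoef R u n i l).
Proof.
have := unit_moment_decay; rewrite /pcoef /unit_moment; case: (model u) => ud.
  apply: decays_sum_nat => h /andP[lh _].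
  by apply: decaysZ; apply: decaysW lh (ud h).
by apply: eq_decays (decaysZ (stirling2 i l)%:R (ud l)) => n; rewrite mulrA.
Qed.

Lemma fcoef_diag n s :
  f n.+1 s s = \sum_(0 <= j < s.+1) 'C(s, j)%:R * Cst R u ^+ j * unit_moment n j.
Proof.
rewrite /fcoef subnn; apply: eq_bigr => j _; rewrite subn0 !big_nat1.
rewrite !subnn !binn !expr0 pcoef_diag /Cst !expr_div_n !exprMn.
have mj : m%:R ^+ j != 0 :> R by rewrite expf_neq0// pnatr_eq0 -lt0n.
by rewrite !mulr1 !mul1r; field.
Qed.

Lemma Cst_gt0 : 0 < Cst R u.
Proof. by apply: divr_gt0; [apply: mulr_gt0 => //|]; rewrite ltr0n. Qed.

Lemma fcoef_diag_ge1 n s : 1 <= f n.+1 s s.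
Proof.
rewrite fcoef_diag big_nat_recl// bin0 expr0 !mul1r unit_moment0 lerDl.
by apply: sumr_ge0 => j _; rewrite !mulr_ge0 ?unit_moment_ge0 ?exprn_ge0 ?(ltW Cst_gt0).
Qed.

Lemma fcoef_diag_gt0 n s : 0 < f n s s.
Proof. by case: n => [|n]; [exact: ltr01|exact: lt_le_trans ltr01 (fcoef_diag_ge1 n s)]. Qed.

Lemma fcoef_diag_neq0 n s : f n s s != 0.
Proof. by rewrite gt_eqF// fcoef_diag_gt0. Qed.

Lemma inv_total_decay n : (T n)%:R^-1 <= n.+1%:R^-1 :> R.
Proof.
rewrite lef_pV2 ?posrE ?ltr0n//; last by rewrite (leq_trans _ (total_balls_ge n))// addn_gt0 hm.
by rewrite ler_nat (leq_trans _ (total_balls_ge n))// -add1n leq_add2r.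
Qed.

Lemma decays_invT : decays 1 (fun n => (T n)%:R^-1 : R).
Proof.
exists 1 => n; rewrite ger0_norm ?invr_ge0// mul1r expr1.
exact: inv_total_decay.
Qed.

(** Only the summands j = 0 and j = 1 of the diagonal coefficient contribute to
    first order, and they are the same in both models. *)
Lemma fcoef_diag_asym s :
  asym (fun n => real_complex R (f n.+2 s s)) (real_complex R (s%:R * L)).
Proof.
suff [K hK] : decays 2 (fun n => f n.+2 s s - 1 - s%:R * L / n.+1%:R).
  exists K => n; apply: le_trans (hK n).
  have rcE (y z : R) (k : nat) : real_complex R (y - 1 - z / k%:R) =
      real_complex R y - 1 - real_complex R z / k%:R.
    by rewrite !rmorphB rmorph1 rmorphM fmorphV rmorph_nat.
  by rewrite -(normc_real (f n.+2 s s - 1 - _)) rcE.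
case: s => [|s].
  exists 0 => n; rewrite fcoef_diag big_nat1 bin0 expr0 unit_moment0 !mul1r.
  by rewrite subrr mul0r mul0r subrr normr0.
have T0 n : (T n)%:R != 0 :> R.
  by rewrite pnatr_eq0 -lt0n (leq_trans _ (total_balls_ge n))// addn_gt0 hm.
have mR : m%:R != 0 :> R by rewrite pnatr_eq0 -lt0n.
pose e1 n : R := - (s.+1%:R * L * (T 0)%:R) * ((T n.+1)%:R^-1 * n.+1%:R^-1).
have e1d : decays 2 e1.
  apply: decaysZ.
  apply: (@decaysM _ 1 1 (fun n => (T n.+1)%:R^-1) (fun n => n.+1%:R^-1)).
    exact: decaysS decays_invT.
  by apply: eq_decays (decays_inv _ 1) => n; rewrite expr1.
pose e2 n := \sum_(2 <= j < s.+2) 'C(s.+1, j)%:R * Cst R u ^+ j * unit_moment n.+1 j.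
have e2d : decays 2 e2.
  apply: decays_sum_nat => j /andP[j2 _]; apply: decaysZ.
  exact: decaysS (decaysW j2 (unit_moment_decay j)).
apply: eq_decays (decaysD e1d e2d) => n.
rewrite fcoef_diag big_ltn// big_ltn// -/(e2 n) bin0 bin1 unit_moment0 unit_moment1.
rewrite !expr0 !expr1 !mul1r /e1 /Cst.
have -> : (T n.+1)%:R = (T 0)%:R + (sigma u)%:R * n.+1%:R :> R.
  by rewrite total_ballsE natrD natrM.
field; rewrite mR; rewrite -?natrM -?natrD ?pnatr_eq0; rewrite -?[1 + n]/(n.+1).
by rewrite nat1r pnatr_eq0 /= -natrM -natrD -total_ballsE T0.
Qed.

Let fcoef_summand (s d j n : nat) : R := 'C(s, j)%:R * L ^+ j *
  \sum_(j - d <= l < j.+1) 'C(l, j - d)%:R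
    * ((addw u m)%:~R * n%:R / (1 - L)) ^+ (l - (j - d)) *
    \sum_(l <= i < j.+1) 'C(j, i)%:R
      * ((sigma u)%:R ^+ i * (addw u m)%:~R ^+ (j - i) / (m%:R ^+ i * (L - 1) ^+ (j - i)))
      * pcoef R u n i l.

Let fcoef_summandE n s r :
  f n.+1 s r = \sum_(s - r <= j < s.+1) fcoef_summand s (s - r) j n.
Proof. by []. Qed.

Let fcoef_summand_decay s d j : decays (j - d) (fcoef_summand s d j).
Proof.
apply: decaysZ; apply: decays_sum_nat => l /andP[jl _].
pose e n : R := \sum_(l <= i < j.+1) 'C(j, i)%:R
      * ((sigma u)%:R ^+ i * (addw u m)%:~R ^+ (j - i) / (m%:R ^+ i * (L - 1) ^+ (j - i)))
      * pcoef R u n i l.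
have el : decays l e by apply: decays_sum_nat => i _; apply: decaysZ; exact: pcoef_decay.
have := decays_growth ((addw u m)%:~R / (1 - L)) (leq_subr (j - d) l) el.
rewrite subKn// => /(decaysZ 'C(l, j - d)%:R); apply: eq_decays => n.
by rewrite mulrA [_ * n%:R / _]mulrAC.
Qed.

(** No decay is to be expected from height 2 on: these coefficients involve the
    centred moments of a single sample, whose size does not depend on n. *)
Lemma fcoef_decay0 s r : decays 0 (fun n => f n.+1 s r).
Proof.
apply: decays_sum_nat => j /andP[srj _].
exact: decaysW (leq0n _) (fcoef_summand_decay s (s - r) j).
Qed.

Let pcoef10 n : pcoef R u n 1 0 = 0.
Proof.
rewrite /pcoef; case: (model u); last by rewrite /= mul0r mul0r.
by rewrite (minn_idPl hm) !big_nat_recl// big_geq//= !(mulr0, mul0r, addr0).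
Qed.

(** The shift of W_n is chosen so that the mean displacement in one step, at
    shifted content 0, is O(1/n). *)
Lemma fcoef_decay1 s : decays 1 (fun n => f n.+1 s.+1 s).
Proof.
have T0 n : (T n)%:R != 0 :> R.
  by rewrite pnatr_eq0 -lt0n (leq_trans _ (total_balls_ge n))// addn_gt0 hm.
have mR : m%:R != 0 :> R by rewrite pnatr_eq0 -lt0n.
have L1 : 1 - L != 0 by have /andP[_ L1] := hLambda; rewrite subr_eq0 gt_eqF.
have L1' : L - 1 != 0 by rewrite -opprB oppr_eq0.
pose e1 n : R := - (s.+1%:R * L * (addw u m)%:~R / (1 - L) * (T 0)%:R) * (T n)%:R^-1.
pose e2 n := \sum_(2 <= j < s.+2) fcoef_summand s.+1 1 j n.
have e1d : decays 1 e1 by apply: decaysZ; exact: decays_invT.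
have e2d : decays 1 e2.
  apply: decays_sum_nat => j /andP[j2 _]; apply: decaysW (fcoef_summand_decay _ _ _).
  by rewrite ltn_subRL.
apply: eq_decays (decaysD e1d e2d) => n.
rewrite fcoef_summandE subSnn big_ltn// -/(e2 n); congr (_ + _).
rewrite /fcoef_summand subnn big_ltn// !big_nat1 big_ltn// !big_nat1.
rewrite !subnn !subn0 !bin0 !bin1 !expr0 !expr1 pcoef10 !pcoef_diag.
rewrite unit_moment0 unit_moment1 /e1.
have -> : (T 0)%:R = (T n)%:R - (sigma u)%:R * n%:R :> R.
  by rewrite [in RHS]total_ballsE natrD natrM addrK.
rewrite !(mulr0, mul1r, mulr1, addr0).
rewrite -(opprB 1 L); move: (T0 n) mR L1; move: ((T n)%:R : R) (m%:R : R).
by move=> t mm t0 m0 L1; field; rewrite t0 m0 L1.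
Qed.

Lemma diag_prod_gt0 p n : 0 < diag_prod R u p n.
Proof.
rewrite /diag_prod; elim/big_ind: _ => // [y z|j _]; first exact: mulr_gt0.
exact: fcoef_diag_gt0.
Qed.

(** After division by n^(p Lambda) the quotients of consecutive terms are
    1 + O(1/n^2). *)
Lemma diag_prod_limit p : exists2 c : R, 0 < c &
  (fun n : nat => diag_prod R u p n / n%:R `^ (p%:R * L)) @ \oo --> c.
Proof.
pose x := p%:R * L.
have f0 n : real_complex R (f n.+2 p p) != 0 by rewrite fmorph_eq0 fcoef_diag_neq0.
pose e n := real_complex R (f n.+2 p p) *
  (natpow n.+2 (- real_complex R x) / natpow n.+1 (- real_complex R x)).
pose v (n : nat) : R := diag_prod R u p n / n%:R `^ x.
have npx n : natpow n.+1 (- real_complex R x) = real_complex R (n.+1%:R `^ x)^-1.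
  by rewrite -rmorphN natpow_real powRN.
have v0 n : 0 < v n.+1.
  rewrite /v divr_gt0 ?powR_gt0 ?ltr0n//.
  exact: diag_prod_gt0.
have [||||z [zr zi] z0] := @asym0_ccvg_neq0 R e (fun n => real_complex R (v n.+1)).
- rewrite -(subrr (real_complex R x)); apply: asymM; last exact: asym_natpow.
  exact: fcoef_diag_asym.
- move=> n; rewrite /e !npx -!fmorph_div -!rmorphM; congr (real_complex R _).
  have y0 : n.+1%:R `^ x != 0 by rewrite gt_eqF// powR_gt0 ?ltr0n.
  have y1 : n.+2%:R `^ x != 0 by rewrite gt_eqF// powR_gt0 ?ltr0n.
  by rewrite /v diag_prodS; field; rewrite y0 y1.
- by move=> n; rewrite mulf_neq0// mulf_neq0 ?invr_eq0 ?natpow_neq0.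
- by rewrite fmorph_eq0 gt_eqF.
have zi0 : complex.Im z = 0.
  by apply: (cvg_unique _ zi); rewrite //=; exact: cvg_cst.
have vz : v @ \oo --> complex.Re z by rewrite -(cvg_shiftS v).
exists (complex.Re z) => //; rewrite lt0r; apply/andP; split.
  by apply: contra z0 => /eqP zr0; case: z zr0 zi0 {zr zi vz} => /= ? ? -> ->.
rewrite -(cvg_lim _ vz)//; apply: limr_ge; first by apply: cvgP vz.
by near=> n; rewrite -(@prednK n) ?(ltW (v0 _))//; near: n; exact: nbhs_infty_gt.
Unshelve. all: by end_near. Qed.

Lemma diag_prod_bounds p : exists2 K : R, 0 <= K & forall n,
  diag_prod R u p n.+1 <= K * n.+1%:R `^ (p%:R * L) /\
  n.+1%:R `^ (p%:R * L) <= K * diag_prod R u p n.+1.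
Proof.
have [c c0 hc] := diag_prod_limit p.
have bnd (w : nat -> R) : cvgn w -> exists2 K : R, 0 <= K & forall n, w n <= K.
  move=> /cvg_seq_bounded[M [_ hM]]; exists (`|M| + 1); first by rewrite addr_ge0.
  move=> n; apply: le_trans (ler_norm _) _; apply: hM => //.
  by apply: le_lt_trans (ler_norm M) _; rewrite ltrDl.
have [K1 K10 hK1] := bnd _ (cvgP _ hc).
have c0' : c != 0 by rewrite gt_eqF.
have hV : (fun n : nat => (diag_prod R u p n / n%:R `^ (p%:R * L))^-1) @ \oo --> c^-1.
  exact: cvgV c0' hc.
have [K2 K20 hK2] := bnd _ (cvgP _ hV).
exists (K1 + K2) => [|n]; first exact: addr_ge0.
have y0 : 0 < n.+1%:R `^ (p%:R * L) by rewrite powR_gt0 ?ltr0n.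
have D0 := diag_prod_gt0 p n.+1.
split.
  have := hK1 n.+1; rewrite ler_pdivrMr// => /le_trans; apply.
  by rewrite ler_wpM2r ?(ltW y0)// lerDl.
have := hK2 n.+1; rewrite invf_div ler_pdivrMr// => /le_trans; apply.
by rewrite ler_wpM2r ?(ltW D0)// lerDr.
Qed.

(** A jump of height h has weight O(n^(- h Lambda)) times its coefficient. This is
    O(n^(-1 - Lambda)) for h = 1, and Lambda < 1; for h at least 2 the coefficient
    is only bounded. *)
Lemma jump_le p q : (q < p)%N -> exists2 K : R, 0 <= K & forall n,
  `|jump R u n.+1 p q| <= K * n.+1%:R `^ (- (2 * L)).
Proof.
move=> qp; have [Kq Kq0 hq] := diag_prod_bounds q; have [Kp Kp0 hp] := diag_prod_bounds p.
have L0 := L_gt0; have /andP[_ L1] := hLambda.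
have [F F0 hF] : exists2 F : R, 0 <= F & forall n,
    `|f n.+1 p q| * n.+1%:R `^ (q%:R * L - p%:R * L) <= F * n.+1%:R `^ (- (2 * L)).
  have x1 n : 1 <= n.+1%:R :> R by rewrite ler1n.
  have [q1p|q1p] := eqVneq p q.+1.
    have := decays_ge0 (fcoef_decay1 q); rewrite q1p => -[F F0 hF]; exists F => // n.
    have {}hF := hF n; rewrite expr1 in hF.
    rewrite -(natr1 q) mulrDl mul1r opprD addNKr.
    apply: le_trans (ler_wpM2r (powR_ge0 _ _) hF) _.
    rewrite -mulrA ler_wpM2l// -[X in X^-1 * _](powRr1 (ler0n _ _)) -powRN -powRD; last first.
      by rewrite pnatr_eq0 implybT.
    by apply: ler_powR => //; lra.
  have [F F0 hF] := decays_ge0 (fcoef_decay0 p q); exists F => // n.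
  have {}hF := hF n; rewrite expr0 divr1 in hF.
  apply: ler_pM => //; rewrite ?powR_ge0//; apply: ler_powR => //.
  have : (q.+2 <= p)%N by rewrite ltn_neqAle eq_sym q1p.
  rewrite -(ler_nat R) -addn2 natrD => q2p.
  by rewrite -mulrBl -mulNr ler_wpM2r ?(ltW L0)//; lra.
exists (F * Kq * Kp) => [|n]; first by rewrite !mulr_ge0.
have Dp := diag_prod_gt0 p n.+1; have Dq := diag_prod_gt0 q n.
have [hq1 _] := hq n; have [_ hp2] := hp n.
have y0 : 0 < n.+1%:R `^ (p%:R * L) by rewrite powR_gt0 ?ltr0n.
have z0 : 0 < n.+1%:R `^ (q%:R * L) by rewrite powR_gt0 ?ltr0n.
rewrite /jump /= !normrM normfV (gtr0_norm Dp) (gtr0_norm Dq).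
have DqS : diag_prod R u q n <= Kq * n.+1%:R `^ (q%:R * L).
  apply: le_trans hq1; rewrite diag_prodS ler_peMr ?(ltW Dq)//.
  exact: fcoef_diag_ge1.
have DpV : (diag_prod R u p n.+1)^-1 <= Kp / n.+1%:R `^ (p%:R * L).
  by rewrite ler_pdivlMr// mulrC ler_pdivrMr.
apply: (@le_trans _ _ (`|f n.+1 p q| * (Kq * n.+1%:R `^ (q%:R * L))
    * (Kp / n.+1%:R `^ (p%:R * L)))).
  apply: ler_pM => //; first by rewrite mulr_ge0// ltW.
    by rewrite invr_ge0 ltW.
  by rewrite ler_wpM2l.
have := hF n; rewrite powRB ?pnatr_eq0 ?implybT// => h.
rewrite [leLHS](_ : _ = Kq * Kp * (`|f n.+1 p q|
  * (n.+1%:R `^ (q%:R * L) / n.+1%:R `^ (p%:R * L)))); last by ring.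
rewrite [leRHS](_ : _ = Kq * Kp * (F * n.+1%:R `^ (- (2 * L)))); last by ring.
by rewrite ler_wpM2l ?mulr_ge0.
Qed.

Lemma power_sum_le (r : R) : 0 < r -> exists B : R, forall n,
  \sum_(i < n) i.+1%:R `^ (- (1 + r)) <= B.
Proof.
move=> r0.
(* the sum telescopes against the decreasing sequence n^(-r) *)
pose S n : R := \sum_(i < n) i.+1%:R `^ (- (1 + r)).
suff h n : r * S n.+1 <= r + (1 - n.+1%:R `^ (- r)).
  exists ((r + 1) / r) => -[|n].
    by rewrite big_ord0 divr_ge0 ?addr_ge0 ?ltW.
  rewrite ler_pdivlMr// mulrC; apply: le_trans (h n) _.
  by rewrite lerD2l gerBl powR_ge0.
elim: n => [|n IH]; first by rewrite /S big_ord1 powR1 mulr1 subrr addr0.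
have step : r * n.+2%:R `^ (- (1 + r)) <= n.+1%:R `^ (- r) - n.+2%:R `^ (- r).
  have x0 : 0 < n.+2%:R :> R by rewrite ltr0n.
  rewrite opprD powRD ?pnatr_eq0 ?implybT//.
  rewrite (_ : n.+2%:R `^ (-1) = n.+2%:R^-1); last by rewrite powRN powRr1.
  have y0 : 0 < n.+2%:R `^ (- r) by rewrite powR_gt0.
  have -> : n.+1%:R `^ (- r) = n.+2%:R `^ (- r) * expR (r * (ln n.+2%:R - ln n.+1%:R)).
    by rewrite /powR !pnatr_eq0 /= -expRD; congr expR; ring.
  rewrite mulrA -[X in _ <= _ - X]mulr1 -mulrBr mulrC ler_wpM2l ?(ltW y0)//.
  rewrite lerBrDl; apply: le_trans (expR_ge1Dx _); rewrite lerD2l ler_wpM2l ?(ltW r0)//.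
  rewrite -lerN2 opprB -ln_div ?posrE ?ltr0n//.
  rewrite (_ : _ / _ = 1 - n.+2%:R^-1); last first.
    by rewrite -[in LHS](addrK 1 n.+1%:R) natr1 mulrBl mul1r divff ?pnatr_eq0.
  by apply: le_ln1Dx; rewrite ltrN2 invf_lt1// ltr1n.
by rewrite /S big_ord_recr /= mulrDr; move: (lerD IH step); rewrite /S; lra.
Qed.

(** The exponent 2 Lambda exceeds 1: this is where the index has to be large. *)
Lemma jump_dominated s : exists beta : nat -> R, exists B : R,
  [/\ forall i, 0 <= beta i, forall n, \sum_(1 <= i < n.+1) beta i <= B &
      forall i p q, (1 <= i)%N -> (q < p <= s)%N -> `|jump R u i p q| <= beta i].
Proof.
have /choice[K hK] (pq : nat * nat) : exists K : R, 0 <= K /\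
    ((pq.2 < pq.1)%N -> forall n, `|jump R u n.+1 pq.1 pq.2| <= K * n.+1%:R `^ (- (2 * L))).
  case: (ltnP pq.2 pq.1) => [/jump_le[K K0 hK]|_]; last by exists 0.
  by exists K.
pose C := \sum_(p < s.+1) \sum_(q < s.+1) K (val p, val q).
have K0 pq : 0 <= K pq by case: (hK pq).
have C0 : 0 <= C by apply: sumr_ge0 => p _; exact: sumr_ge0.
have KC p q : (q < p <= s)%N -> K (p, q) <= C.
  move=> /andP[qp ps]; have ps' : (p < s.+1)%N by rewrite ltnS.
  have qs' : (q < s.+1)%N by exact: leq_trans qp (leqW ps).
  rewrite /C (bigD1 (Ordinal ps'))//= (bigD1 (Ordinal qs'))//= -addrA lerDl.
  by rewrite addr_ge0//; apply: sumr_ge0 => // ? _; exact: sumr_ge0.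
have r0 : 0 < 2 * L - 1 by have /andP[h _] := hLambda; lra.
have [B hB] := power_sum_le r0.
exists (fun i => C * i%:R `^ (- (2 * L))), (C * B); split => [i|n|i p q i1 pqs].
- by rewrite mulr_ge0// powR_ge0.
- rewrite -mulr_sumr ler_wpM2l// big_add1 /= big_mkord.
  by have := hB n; rewrite (_ : 1 + (2 * L - 1) = 2 * L)//; ring.
- have [_ h] := hK (p, q); rewrite -(prednK i1).
  apply: le_trans (h _ _) _; first by case/andP: pqs.
  by rewrite ler_wpM2r ?powR_ge0// KC.
Qed.

End coefficient_bounds.

(** * Moments of one sample *)

Section stirling.
Variable R : realType.

Lemma exprn_ffact (k i : nat) :
  k%:R ^+ i = \sum_(0 <= h < i.+1) (stirling2 i h)%:R * (k ^_ h)%:R :> R.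
Proof.
elim: i => [|i IH]; first by rewrite big_nat1 expr0 /= ffactn0 mulr1.
rewrite exprSr IH mulr_suml [RHS]big_nat_recl//= mul0r add0r.
have step h : (stirling2 i h)%:R * (k ^_ h)%:R * k%:R =
    (stirling2 i h)%:R * (k ^_ h.+1)%:R + (h * stirling2 i h)%:R * (k ^_ h)%:R :> R.
  have : (k ^_ h * k)%N = (k ^_ h.+1 + h * k ^_ h)%N.
    rewrite ffactnSr; have [hk|kh] := leqP h k; last by rewrite ffact_small// !(muln0, mul0n).
    by rewrite [(h * _)%N]mulnC -mulnDr subnK.
  by move=> E; rewrite -mulrA -natrM E natrD !natrM; ring.
under eq_bigr do rewrite step.
rewrite big_split /=.
under [in RHS]eq_bigr do rewrite natrD mulrDl.
rewrite [in RHS]big_split /= [RHS]addrC; congr (_ + _).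
rewrite big_nat_recl// mul0n mul0r add0r [RHS]big_nat_recr//=.
by rewrite stirling2_small// muln0 mul0r addr0.
Qed.

Lemma ffact_exprn (w h : nat) :
  (w ^_ h)%:R = \sum_(0 <= l < h.+1) (-1) ^+ (h - l) * (stirling1 h l)%:R * w%:R ^+ l :> R.
Proof.
elim: h => [|h IH]; first by rewrite big_nat1 subnn !expr0 ffactn0 !mulr1.
have -> : (w ^_ h.+1)%:R = (w ^_ h)%:R * w%:R - h%:R * (w ^_ h)%:R :> R.
  rewrite ffactnSr; have [hw|wh] := leqP h w; last first.
    by rewrite ffact_small// mul0n !(mul0r, mulr0) subr0.
  by rewrite natrM natrB//; ring.
rewrite IH mulr_suml mulr_sumr -sumrN.
rewrite [RHS]big_nat_recl//= mulr0 mul0r add0r.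
have step l : (l < h.+1)%N ->
    (-1) ^+ (h.+1 - l.+1) * (h * stirling1 h l.+1 + stirling1 h l)%:R * w%:R ^+ l.+1 =
    (-1) ^+ (h - l) * (stirling1 h l)%:R * w%:R ^+ l * w%:R +
    (-1) ^+ (h - l) * (h * stirling1 h l.+1)%:R * w%:R ^+ l.+1 :> R.
  by move=> _; rewrite subSS exprSr natrD; ring.
rewrite (eq_big_nat _ _ (fun l lh => step l (andP lh).2)).
rewrite [RHS]big_split /=; congr (_ + _).
rewrite big_nat_recl//= [RHS]big_nat_recr//= (stirling1_small (ltnSn h)) muln0 mulr0 mul0r addr0.
have -> : h%:R * ((-1) ^+ (h - 0) * (stirling1 h 0)%:R * w%:R ^+ 0) = 0 :> R.
  by case: h {IH step} => [|h] /=; rewrite ?mul0r// mulr0 mul0r mulr0.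
rewrite oppr0 add0r big_nat [RHS]big_nat; apply: eq_bigr => l /andP[_ lh].
by rewrite -(subnSK lh) natrM; move: (h - l.+1)%N => d; rewrite (exprS _ d); ring.
Qed.

End stirling.

Section hypergeometric.

(** Both sides count the pairs of a k-subset of w and an injective h-word in it. *)
Lemma ffact_bin w k h : (h <= k)%N -> (k ^_ h * 'C(w, k) = w ^_ h * 'C(w - h, k - h))%N.
Proof.
elim: h => [|h IH] hk; first by rewrite !ffactn0 !subn0.
rewrite !ffactnSr mulnAC IH ?(ltnW hk)// -!mulnA; congr (_ * _)%N.
by rewrite mulnC -(subnSK hk) -mul_bin_diag -subnS.
Qed.

Lemma sum_ffact_Vandermonde w b m h : (h <= m)%N ->
  (\sum_(k < m.+1) k ^_ h * ('C(w, k) * 'C(b, m - k)) =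
   w ^_ h * 'C(w + b - h, m - h))%N.
Proof.
move=> hm; have [wh|hw] := ltnP w h.
  rewrite [in RHS]ffact_small// mul0n big1// => k _.
  have [kh|hk] := ltnP k h; first by rewrite ffact_small.
  by rewrite (@bin_small w) ?(leq_trans wh)// mul0n muln0.
rewrite -(big_mkord xpredT (fun k => k ^_ h * ('C(w, k) * 'C(b, m - k)))%N).
rewrite (big_cat_nat (n := h))//=; last exact: leqW.
rewrite big_nat big1 ?add0n => [|k /andP[_ kh]]; last by rewrite ffact_small.
rewrite -{1}(add0n h) big_addn subSn//.
rewrite big_mkord -addnBAC// -binomial.Vandermonde big_distrr /=.
apply: eq_bigr => k _; rewrite mulnA ffact_bin ?leq_addl// addnK -mulnA.
by rewrite subnDA subnAC.
Qed.

Lemma sum_ffact_binomial w b m h : (h <= m)%N ->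
  (\sum_(k < m.+1) k ^_ h * ('C(m, k) * w ^ k * b ^ (m - k)) =
   m ^_ h * w ^ h * (w + b) ^ (m - h))%N.
Proof.
move=> hm.
rewrite -(big_mkord xpredT (fun k => k ^_ h * ('C(m, k) * w ^ k * b ^ (m - k)))%N).
rewrite (big_cat_nat (n := h))//=; last exact: leqW.
rewrite big_nat big1 ?add0n => [|k /andP[_ kh]]; last by rewrite ffact_small.
rewrite -{1}(add0n h) big_addn subSn//.
rewrite big_mkord addnC expnDn big_distrr /=.
apply: eq_bigr => k _; rewrite !mulnA ffact_bin ?leq_addl// addnK expnD.
by rewrite subnDA subnAC; ring.
Qed.

End hypergeometric.

Section sample_moments.
Variables (R : realType) (u : urn).
Hypothesis (hm : (1 <= ssize u)%N) (hsigma : (1 <= sigma u)%N).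
Hypothesis hT0 : (ssize u <= total_balls u 0)%N.
Hypothesis haff : affine u.
Hypothesis hLambda : 2^-1 < Lambda R u < 1.
Local Notation m := (ssize u).
Local Notation T := (total_balls u).
Local Notation L := (Lambda R u).
Local Notation a := ((addw u m)%:~R : R).

Let T_ge n : (m + n <= T n)%N.
Proof. exact: total_balls_ge. Qed.

Lemma factorial_moment n w b h : (w + b = T n)%N ->
  \sum_(k < m.+1) draw_prob R u w%:Z b%:Z k * (k ^_ h)%:R =
  unit_moment R u n h *
  (match model u with without_replacement => w ^_ h | with_replacement => w ^ h end)%:R.
Proof.
move=> wb.
have mT : (m <= T n)%N by apply: leq_trans (T_ge n); rewrite leq_addr.
have -> : \sum_(k < m.+1) draw_prob R u w%:Z b%:Z k * (k ^_ h)%:R =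
    (\sum_(k < m.+1) k ^_ h * draw_weight u w b k)%:R / (draw_weights u (T n))%:R.
  rewrite natr_sum mulr_suml; apply: eq_bigr => k _.
  by rewrite /draw_prob !absz_nat wb natrM; ring.
have [mh|hm'] := ltnP m h.
  rewrite unit_moment_small// mul0r big1 ?mul0r// => k _.
  by rewrite ffact_small//; apply: leq_ltn_trans mh; rewrite -ltnS.
rewrite /draw_weight /draw_weights /unit_moment; case: (model u).
  rewrite sum_ffact_Vandermonde// wb.
  have C1 : 'C(T n, m)%:R != 0 :> R by rewrite pnatr_eq0 -lt0n bin_gt0.
  have C2 : 'C(T n, h)%:R != 0 :> R by rewrite pnatr_eq0 -lt0n bin_gt0 (leq_trans hm').
  have h1 : ('C(T n, h) * 'C(T n - h, m - h) = 'C(m, h) * 'C(T n, m))%N.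
    apply/eqP; rewrite -(eqn_pmul2l (fact_gt0 h)) !mulnA ![(h`! * _)%N]mulnC !bin_ffact.
    by rewrite ffact_bin.
  have := congr1 (fun x : nat => x%:R : R) h1; rewrite !natrM => h2.
  have -> : 'C(T n - h, m - h)%:R = 'C(m, h)%:R * 'C(T n, m)%:R / 'C(T n, h)%:R :> R.
    by rewrite -h2 mulrAC divff// mul1r.
  by field; rewrite C1 C2.
rewrite sum_ffact_binomial// wb.
have T1 : (T n)%:R != 0 :> R by rewrite pnatr_eq0 -lt0n (leq_trans _ mT).
rewrite !natrM !natrX.
rewrite (_ : (T n)%:R ^+ m = (T n)%:R ^+ (m - h) * (T n)%:R ^+ h); last by rewrite -exprD subnK.
field.
by rewrite !expf_neq0.
Qed.

Lemma draw_moment n w b i : (w + b = T n)%N ->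
  \sum_(k < m.+1) draw_prob R u w%:Z b%:Z k * k%:R ^+ i =
  \sum_(0 <= l < i.+1) pcoef R u n i l * w%:R ^+ l.
Proof.
move=> wb.
under eq_bigr => k _ do rewrite exprn_ffact mulr_sumr.
rewrite exchange_big /=.
have E h : \sum_(k < m.+1) draw_prob R u w%:Z b%:Z k * ((stirling2 i h)%:R * (k ^_ h)%:R) =
    (stirling2 i h)%:R * (unit_moment R u n h *
    (match model u with without_replacement => w ^_ h | with_replacement => w ^ h end)%:R).
  by rewrite -(factorial_moment h wb) mulr_sumr; apply: eq_bigr => k _; rewrite mulrCA.
under eq_bigr do rewrite E.
have := @unit_moment_small R u n.
rewrite /pcoef /unit_moment; case: (model u) => small; last first.
  by apply: eq_bigr => h _; rewrite natrX !mulrA.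
transitivity (\sum_(0 <= h < i.+1) \sum_(0 <= l < i.+1 | (l <= h)%N)
    (-1) ^+ (h - l) * (stirling1 h l)%:R * (stirling2 i h)%:R
    * ('C(m, h)%:R / 'C(T n, h)%:R) * w%:R ^+ l : R).
  rewrite big_nat [RHS]big_nat; apply: eq_bigr => h /andP[_ hi].
  rewrite ffact_exprn !mulr_sumr (big_nat_widen _ _ i.+1)//=.
  by apply: eq_bigr => l _; ring.
rewrite (exchange_big_dep_nat xpredT)//=; rewrite big_nat [RHS]big_nat.
apply: eq_bigr => l /andP[_ li].
rewrite -mulr_suml; congr (_ * _).
rewrite [RHS](big_nat_widen _ _ i.+1) ?ltnS ?geq_minl//.
rewrite [RHS](big_nat_widenl _ 0)//=.
rewrite [RHS]big_mkcond [LHS]big_mkcond /=.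
rewrite big_nat [RHS]big_nat; apply: eq_bigr => h /andP[_ hi].
rewrite ltnS in hi; rewrite ltnS leq_min hi /= andbC.
have [hm'|mh] := leqP h m; first by rewrite andbT.
by rewrite andbF small// mulr0; case: ifP.
Qed.

Lemma shifted_step n (w : int) k : (k <= m)%N ->
  shifted R u n.+1 (w + addw u (m - k)) =
  shifted R u n w + L * ((sigma u)%:R / m%:R * k%:R + a / (L - 1)).
Proof.
move=> km; rewrite /shifted haff ?leq_subr// subKn//.
have mR : m%:R != 0 :> R by rewrite pnatr_eq0 -lt0n.
have sR : (sigma u)%:R != 0 :> R by rewrite pnatr_eq0 -lt0n.
have L1 : 1 - L != 0 by have /andP[_ L1] := hLambda; rewrite subr_eq0 gt_eqF.
have cE : (addw u m.-1 - addw u m)%:~R = L * (sigma u)%:R / m%:R :> R.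
  by rewrite /Lambda; field; rewrite mR sR.
rewrite !intrD intrM cE -(opprB 1 L) -natr1.
rewrite -[(Posz k)%:~R]/(k%:R); move: L L1 => l L1; field.
by rewrite mR L1.
Qed.

(** The coefficients f are those of the conditional moments of the shifted
    content as polynomials in the previous one. *)
Lemma step_moment n w b s : (w + b = T n)%N ->
  \sum_(k < m.+1) draw_prob R u w%:Z b%:Z k *
    shifted R u n.+1 (w%:Z + addw u (m - k)) ^+ s =
  \sum_(0 <= r < s.+1) fcoef R u n.+1 s r * shifted R u n w%:Z ^+ r.
Proof.
move=> wb; set x := shifted R u n w%:Z.
pose y := a * n%:R / (1 - L).
have wE : w%:R = x + y :> R by rewrite /x /shifted /y -[(Posz w)%:~R]/(w%:R) [a * _]mulrC subrK.
pose c j i := 'C(j, i)%:R * ((sigma u)%:R ^+ i * a ^+ (j - i) / (m%:R ^+ i * (L - 1) ^+ (j - i))).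
pose M i := \sum_(k < m.+1) draw_prob R u w%:Z b%:Z k * k%:R ^+ i.
have powE k j : ((sigma u)%:R / m%:R * k%:R + a / (L - 1)) ^+ j =
    \sum_(0 <= i < j.+1) c j i * k%:R ^+ i.
  rewrite addrC exprDn big_mkord; apply: eq_bigr => i _.
  rewrite -mulr_natl /c !exprMn !exprVn invfM; ring.
transitivity (\sum_(0 <= j < s.+1) 'C(s, j)%:R * x ^+ (s - j) * L ^+ j *
    \sum_(0 <= i < j.+1) c j i * M i).
  transitivity (\sum_(k < m.+1) \sum_(0 <= j < s.+1) 'C(s, j)%:R * x ^+ (s - j) * L ^+ j *
      \sum_(0 <= i < j.+1) c j i * (draw_prob R u w%:Z b%:Z k * k%:R ^+ i)).
    apply: eq_bigr => k _; have km : (k <= m)%N by rewrite -ltnS.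
    rewrite shifted_step// -/x exprDn big_mkord mulr_sumr.
    apply: eq_bigr => j _; rewrite exprMn powE -mulr_natl !mulr_sumr.
    by apply: eq_bigr => i _; ring.
  rewrite exchange_big /=; apply: eq_bigr => j _; rewrite -mulr_sumr; congr (_ * _).
  by rewrite exchange_big /=; apply: eq_bigr => i _; rewrite -mulr_sumr.
have ME i : M i = \sum_(0 <= l < i.+1) pcoef R u n i l * (x + y) ^+ l.
  by rewrite /M (draw_moment i wb) wE.
(* for each j, the inner double sum is a polynomial in x of degree j *)
have inner j : \sum_(0 <= i < j.+1) c j i * M i =
    \sum_(0 <= q < j.+1) x ^+ q * \sum_(q <= l < j.+1) 'C(l, q)%:R * y ^+ (l - q) *
      \sum_(l <= i < j.+1) c j i * pcoef R u n i l.
  transitivity (\sum_(0 <= i < j.+1) \sum_(0 <= l < j.+1 | (l <= i)%N)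
      c j i * pcoef R u n i l * (x + y) ^+ l).
    rewrite big_nat [RHS]big_nat; apply: eq_bigr => i /andP[_ ij].
    rewrite ME mulr_sumr (big_nat_widen _ _ j.+1)//=.
    by apply: eq_bigr => l _; rewrite mulrA.
  rewrite (exchange_big_dep_nat xpredT)//=.
  transitivity (\sum_(0 <= l < j.+1) \sum_(0 <= q < j.+1 | (q <= l)%N)
      x ^+ q * ('C(l, q)%:R * y ^+ (l - q) * \sum_(l <= i < j.+1) c j i * pcoef R u n i l)).
    rewrite big_nat [RHS]big_nat; apply: eq_bigr => l /andP[_ lj].
    rewrite -mulr_suml.
    rewrite (_ : \sum_(0 <= i < j.+1 | (l <= i)%N) c j i * pcoef R u n i l =
      \sum_(l <= i < j.+1) c j i * pcoef R u n i l); last by rewrite [RHS](big_nat_widenl _ 0).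
    have -> : (x + y) ^+ l = \sum_(0 <= q < l.+1) x ^+ q * ('C(l, q)%:R * y ^+ (l - q)).
      rewrite addrC exprDn big_mkord; apply: eq_bigr => q _.
      by rewrite -mulr_natl; ring.
    rewrite [LHS]mulr_sumr [LHS](big_nat_widen _ _ j.+1)//=.
    by apply: eq_bigr => q _; ring.
  rewrite (exchange_big_dep_nat xpredT)//=.
  rewrite big_nat [RHS]big_nat; apply: eq_bigr => q /andP[_ qj].
  by rewrite mulr_sumr [RHS](big_nat_widenl _ 0).
under eq_bigr do rewrite inner.
(* the exponent r = s - j + q of x is fixed before j *)
transitivity (\sum_(0 <= j < s.+1) \sum_(0 <= r < s.+1 | (s - r <= j)%N)
   x ^+ r * ('C(s, j)%:R * L ^+ j * \sum_(j - (s - r) <= l < j.+1) 'C(l, j - (s - r))%:R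
      * y ^+ (l - (j - (s - r))) * \sum_(l <= i < j.+1) c j i * pcoef R u n i l)).
  rewrite big_nat [RHS]big_nat; apply: eq_bigr => j /andP[_ js].
  rewrite ltnS in js.
  have -> : \sum_(0 <= r < s.+1 | (s - r <= j)%N)
     x ^+ r * ('C(s, j)%:R * L ^+ j * \sum_(j - (s - r) <= l < j.+1) 'C(l, j - (s - r))%:R
      * y ^+ (l - (j - (s - r))) * \sum_(l <= i < j.+1) c j i * pcoef R u n i l) =
     \sum_(0 + (s - j) <= r < s.+1)
     x ^+ r * ('C(s, j)%:R * L ^+ j * \sum_(j - (s - r) <= l < j.+1) 'C(l, j - (s - r))%:R
      * y ^+ (l - (j - (s - r))) * \sum_(l <= i < j.+1) c j i * pcoef R u n i l).
    rewrite [RHS](big_nat_widenl _ 0)//=; apply: eq_bigl => r.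
    by rewrite !leq_subLR addnC.
  rewrite big_addn subSn ?leq_subr// subKn// [LHS]mulr_sumr.
  rewrite [LHS]big_nat [RHS]big_nat; apply: eq_bigr => q /andP[_ qj]; rewrite ltnS in qj.
  have -> : (j - (s - (q + (s - j))) = q)%N by rewrite addnC subnDA subKn// subKn.
  by rewrite exprD; ring.
rewrite (exchange_big_dep_nat xpredT)//=.
rewrite big_nat [RHS]big_nat; apply: eq_bigr => r /andP[_ rs].
rewrite /fcoef [RHS]mulrC mulr_sumr [RHS](big_nat_widenl _ 0)//=.
Qed.

End sample_moments.

(** * Moments of the urn *)

Section process.
Variables (R : realType) (u : urn).
Hypothesis (hm : (1 <= ssize u)%N) (hsigma : (1 <= sigma u)%N).
Hypothesis (hbal : balanced u) (haff : affine u) (hten : tenable u).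
Hypothesis hT0 : (ssize u <= total_balls u 0)%N.
Hypothesis hLambda : 2^-1 < Lambda R u < 1.
Variables (d : measure_display) (Omega : measurableType d) (P : probability Omega R).
Variable K : nat -> {RV P >-> nat}.
Hypothesis hK : urn_process u K.
Local Notation m := (ssize u).
Implicit Types t : seq nat.

(** The numbers of white balls in the first n samples, in the order of the draws:
    the last sample is at the end, since its law depends on all the others. *)
Fixpoint histories n : seq (seq nat) :=
  if n is n'.+1 then [seq rcons t k | t <- histories n', k <- index_iota 0 m.+1]
  else [:: [::]].

Lemma mem_histories n t : t \in histories n = (size t == n) && all (leq^~ m) t.
Proof.
elim: n t => [|n IH] t; first by case: t.
apply/allpairsP/andP => [[[y k] /= [yt + ->]]|[]].
  rewrite mem_index_iota ltnS => /andP[_ km].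
  by move: yt; rewrite IH size_rcons eqSS all_rcons => /andP[-> ->]; rewrite km.
case/lastP: t => [//|t k]; rewrite size_rcons eqSS all_rcons => st /andP[km am].
exists (t, k); split => //=; first by rewrite IH st.
by rewrite mem_index_iota ltnS.
Qed.

Lemma histories_size n t : t \in histories n -> size t = n.
Proof. by rewrite mem_histories => /andP[/eqP]. Qed.

Lemma uniq_histories n : uniq (histories n).
Proof.
elim: n => [//|n IH]; apply: allpairs_uniq; rewrite ?iota_uniq//.
by move=> [y k] [y' k'] _ _ /= /rcons_inj[-> ->].
Qed.

Lemma sum_histories (V : nmodType) n (F : seq nat -> V) :
  \sum_(t <- histories n.+1) F t = \sum_(t <- histories n) \sum_(k < m.+1) F (rcons t k).
Proof.
rewrite big_allpairs_dep; apply: eq_bigr => t _.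
by rewrite -(big_mkord xpredT (fun k => F (rcons t k))).
Qed.

Definition history_event t : set Omega := [set w | forall i, (i < size t)%N -> K i w = nth 0%N t i].

Lemma history_event_rcons t k : history_event (rcons t k) =
  history_event t `&` (K (size t) @^-1` [set k]).
Proof.
apply/seteqP; split => w /=.
  move=> h; split => [i it|].
    by rewrite h ?size_rcons ?(ltn_trans it)// nth_rcons it.
  by rewrite h ?size_rcons// nth_rcons ltnn eqxx.
move=> [h hk] i; rewrite size_rcons ltnS leq_eqVlt nth_rcons.
by case/orP => [/eqP->|it]; [rewrite ltnn eqxx|rewrite it h].
Qed.

Lemma measurable_history_event t : measurable (history_event t).
Proof.
elim/last_ind: t => [|t k IH].
  by rewrite (_ : history_event _ = setT)//; apply/seteqP; split.
rewrite history_event_rcons; apply: measurableI => //.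
exact: measurable_funPTI.
Qed.

Lemma white_rcons t k : white u (nth 0%N (rcons t k)) (size t).+1 =
  white u (nth 0%N t) (size t) + addw u (m - k).
Proof.
rewrite /white big_ord_recr /= addrA; congr (_ + _ + _).
  by apply: eq_bigr => i _; rewrite nth_rcons ltn_ord.
by rewrite nth_rcons ltnn eqxx.
Qed.

Lemma black_rcons t k : black u (nth 0%N (rcons t k)) (size t).+1 =
  black u (nth 0%N t) (size t) + Defs.addb u (m - k).
Proof.
rewrite /black big_ord_recr /= addrA; congr (_ + _ + _).
  by apply: eq_bigr => i _; rewrite nth_rcons ltn_ord.
by rewrite nth_rcons ltnn eqxx.
Qed.

Lemma white_prefix h h' n : (forall i, (i < n)%N -> h i = h' i) ->
  white u h n = white u h' n.
Proof. by move=> hh; congr (_ + _); apply: eq_bigr => i _; rewrite hh. Qed.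

Lemma black_prefix h h' n : (forall i, (i < n)%N -> h i = h' i) ->
  black u h n = black u h' n.
Proof. by move=> hh; congr (_ + _); apply: eq_bigr => i _; rewrite hh. Qed.

Definition history_prob t : R := fine (P (history_event t)).

Lemma history_probE t : P (history_event t) = (history_prob t)%:E.
Proof. by rewrite /history_prob fineK// fin_num_measure//; exact: measurable_history_event. Qed.

Lemma history_prob_nil : history_prob [::] = 1.
Proof.
rewrite /history_prob (_ : history_event _ = setT) ?probability_setT//.
by apply/seteqP; split.
Qed.

Lemma history_prob_rcons t k : (k <= m)%N -> history_prob (rcons t k) =
  history_prob t * draw_prob R u (white u (nth 0%N t) (size t)) (black u (nth 0%N t) (size t)) k.
Proof.
move=> km; pose h := nth 0%N (rcons t k).
have hE : h (size t) = k by rewrite /h nth_rcons ltnn eqxx.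
have ht i : (i < size t)%N -> h i = nth 0%N t i by move=> it; rewrite /h nth_rcons it.
have hk : (h (size t) <= m)%N by rewrite hE.
have := hK hk; rewrite hE (white_prefix ht) (black_prefix ht).
have -> : [set w | forall i, (i < (size t).+1)%N -> K i w = h i] = history_event (rcons t k).
  by rewrite /history_event size_rcons.
have -> : [set w | forall i, (i < size t)%N -> K i w = h i] = history_event t.
  by apply/seteqP; split => w /= H i it; rewrite H// ht.
by rewrite !history_probE -EFinM => -[].
Qed.

Lemma reachable_history t : all (leq^~ m) t -> history_prob t != 0 ->
  reachable u (white u (nth 0%N t) (size t)) (black u (nth 0%N t) (size t)).
Proof.
elim/last_ind: t => [_ _|t k IH].
  by rewrite /white /black !big_ord0 !addr0; exact: reachable0.
rewrite all_rcons => /andP[km am]; rewrite history_prob_rcons// mulf_eq0 negb_or => /andP[pt dp].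
rewrite size_rcons white_rcons black_rcons; apply: reachableS => //; first exact: IH.
by move: dp; rewrite /draw_prob mulf_eq0 negb_or pnatr_eq0 -lt0n => /andP[].
Qed.

Lemma total_content t : white u (nth 0%N t) (size t) + black u (nth 0%N t) (size t) =
  (total_balls u (size t))%:Z.
Proof.
elim/last_ind: t => [|t k IH].
  by rewrite /white /black !big_ord0 !addr0 /total_balls muln0 addn0 PoszD.
rewrite size_rcons white_rcons black_rcons addrACA IH hbal ?leq_subr//.
by rewrite -PoszD /total_balls mulnS; congr Posz; ring.
Qed.

(** Reachable contents are genuine numbers of balls, so the moments of the next
    sample are those of the urn with these contents. *)
Lemma history_step t s : all (leq^~ m) t ->
  \sum_(k < m.+1) history_prob (rcons t k) *
    shifted R u (size t).+1 (white u (nth 0%N (rcons t k)) (size t).+1) ^+ s =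
  \sum_(0 <= r < s.+1) fcoef R u (size t).+1 s r *
    (history_prob t * shifted R u (size t) (white u (nth 0%N t) (size t)) ^+ r).
Proof.
move=> am.
under eq_bigr => k _ do rewrite (history_prob_rcons _ (leq_ord k)) white_rcons -mulrA.
under [RHS]eq_bigr do rewrite mulrCA.
rewrite -!mulr_sumr; have [->|pt] := eqVneq (history_prob t) 0; first by rewrite !mul0r.
congr (_ * _).
have [] := hten.1 _ _ (reachable_history am pt); have := total_content t.
case: (white u (nth 0%N t) (size t)) => // w.
case: (black u (nth 0%N t) (size t)) => // b [wb] _ _.
exact: step_moment.
Qed.

Definition history_moment n s : R :=
  \sum_(t <- histories n) history_prob t * shifted R u n (white u (nth 0%N t) n) ^+ s.

Lemma history_momentS n s : history_moment n.+1 s =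
  \sum_(0 <= r < s.+1) fcoef R u n.+1 s r * history_moment n r.
Proof.
rewrite /history_moment sum_histories.
under [RHS]eq_bigr do rewrite mulr_sumr.
rewrite [RHS]exchange_big /=; apply: eq_big_seq => t.
rewrite mem_histories => /andP[/eqP st am].
by rewrite -st history_step.
Qed.

Lemma history_moment0 s : history_moment 0 s = (white0 u)%:R ^+ s.
Proof.
rewrite /history_moment big_seq1 history_prob_nil mul1r /shifted mul0r mul0r subr0.
by rewrite /white big_ord0 addr0.
Qed.

(** The moments and the sums of phi satisfy the same recursion in n. *)
Lemma history_moment_phi n s :
  history_moment n s = \sum_(0 <= k < s.+1) phi R u n s k * (white0 u)%:R ^+ k.
Proof.
have f0 := fcoef_diag_neq0 hm hsigma hLambda.
elim: n s => [|n IH] s.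
  rewrite history_moment0 big_nat_recr//= big_nat big1 ?add0r => [|k /andP[_ ks]].
    by rewrite /phi eqxx big_geq// mul1r.
  case: k ks => [|k] ks.
    by rewrite phi0_paths// /paths0 big_geq// mulr0 mul0r.
  by have ks' := ltnW ks; rewrite phi_paths// paths_empty// mulr0 mul0r.
case: s => [|s].
  rewrite history_momentS !big_nat1 fcoef00 mul1r IH big_nat1.
  by rewrite /phi !eqxx; congr (_ * _); rewrite -!/(diag_prod R u 0 _) !diag_prod0.
rewrite history_momentS.
under eq_bigr => r _ do rewrite IH mulr_sumr.
transitivity (\sum_(0 <= r < s.+2) \sum_(0 <= k < s.+2 | (k <= r)%N)
   fcoef R u n.+1 s.+1 r * (phi R u n r k * (white0 u)%:R ^+ k)).
  rewrite big_nat [RHS]big_nat; apply: eq_bigr => r /andP[_ rs].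
  by rewrite (big_nat_widen _ _ s.+2).
rewrite (exchange_big_dep_nat xpredT)//=.
rewrite big_nat [RHS]big_nat; apply: eq_bigr => k /andP[_ ks].
under eq_bigr do rewrite mulrA.
rewrite -mulr_suml; congr (_ * _).
rewrite -(big_nat_widenl _ 0 _ xpredT)//.
case: k ks => [|k] ks; first by rewrite phi_recursion0.
by rewrite phi_recursion.
Qed.

Lemma measurable_shifted n :
  measurable_fun setT (fun w => shifted R u n (white u (fun i => K i w) n)).
Proof.
rewrite (_ : (fun w => _) = (fun w => ((white0 u)%:R + \sum_(i < n) (addw u (m - K i w))%:~R) -
    n%:R * (addw u m)%:~R / (1 - Lambda R u))); last first.
  by apply/funext => w; rewrite /shifted /white intrD rmorph_sum.
apply: measurable_funB => //; apply: measurable_funD => //.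
apply: measurable_sum => i.
exact: (measurableT_comp (f := fun k : nat => (addw u (m - k))%:~R : R)).
Qed.

Lemma history_event_disjoint n : trivIset [set` histories n] history_event.
Proof.
apply/trivIsetP => t t' /= /histories_size st /histories_size st' tt'.
apply/seteqP; split => // w [/= h h'].
case/eqP: tt'; apply: (@eq_from_nth _ 0%N) => [|i it]; first by rewrite st st'.
by rewrite -h// -h'// st' -st.
Qed.

(** The listed histories are disjoint and have total probability 1, so that their
    complement, on which nothing is known of the samples, does not count. *)
Lemma expectation_history n (g : int -> R) :
  measurable_fun setT (fun w => g (white u (fun i => K i w) n)) ->
  'E_P[fun w => g (white u (fun i => K i w) n)]%E =
  (\sum_(t <- histories n) history_prob t * g (white u (nth 0%N t) n))%:E.
Proof.
move=> mX; pose X w := g (white u (fun i => K i w) n).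
pose D := \big[setU/set0]_(t <- histories n) history_event t.
have mD : measurable D by apply: bigsetU_measurable => t _; exact: measurable_history_event.
have pieces (f : Omega -> R) : measurable_fun setT f ->
    (\int[P]_(w in D) (f w)%:E = \sum_(t <- histories n) \int[P]_(w in history_event t) (f w)%:E)%E.
  move=> mf; apply: integral_bigsetU_EFin => //.
  - by move=> t; exact: measurable_history_event.
  - exact: uniq_histories.
  - exact: history_event_disjoint.
  - by apply: measurable_funTS; exact/measurable_EFinP.
have cstE (A : set Omega) (r : R) : measurable A ->
    (\int[P]_(w in A) r%:E = r%:E * P A)%E by move=> mA; exact: integral_cst.
have PD : P D = 1%E.
  rewrite -[LHS]mul1e -cstE// (pieces (fun=> 1))//.
  rewrite (eq_bigr (fun t => (history_prob t)%:E)); last first.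
    by move=> t _; rewrite cstE ?mul1e ?history_probE//; exact: measurable_history_event.
  rewrite sumEFin; congr (_%:E).
  have := history_moment_phi n 0; rewrite /history_moment big_nat1 expr0 mulr1.
  under eq_bigr do rewrite expr0 mulr1.
  by move=> ->; rewrite /phi eqxx -/(diag_prod R u 0 n) diag_prod0.
have PDc : P (~` D) = 0%E by rewrite probability_setC// PD subee.
have mEX : measurable_fun setT (EFin \o X) by exact/measurable_EFinP.
rewrite unlock -(setUv D) integral_setU//; first last.
- by apply/disj_setPCl.
- by rewrite setUv.
- exact: measurableC.
rewrite [X in (_ + X)%E]null_set_integral ?adde0//; first last.
- exact: measurable_funTS.
- exact: measurableC.
rewrite (pieces X)// -sumEFin; apply: eq_big_seq => t /histories_size st.
rewrite (eq_integral (fun=> (g (white u (nth 0%N t) n))%:E)); last first.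
  move=> w; rewrite inE => wt; rewrite /X; congr (g _)%:E.
  by apply: white_prefix => i it; rewrite wt// st.
rewrite cstE; last exact: measurable_history_event.
by rewrite history_probE EFinM muleC.
Qed.

Lemma expectation_shifted_pow n s :
  'E_P[fun w => (shifted R u n (white u (fun i => K i w) n) ^+ s)%R]%E =
  (\sum_(0 <= k < s.+1) phi R u n s k * (white0 u)%:R ^+ k)%:E.
Proof.
rewrite (@expectation_history n (fun w => shifted R u n w ^+ s)).
  by congr (_%:E); exact: history_moment_phi.
by apply: measurable_funX; exact: measurable_shifted.
Qed.

Lemma expectation_normalized_pow n s (c : R) :
  'E_P[fun w => ((shifted R u n (white u (fun i => K i w) n) / c) ^+ s)%R]%E =
  ((\sum_(0 <= k < s.+1) phi R u n s k * (white0 u)%:R ^+ k) / c ^+ s)%:E.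
Proof.
rewrite (@expectation_history n (fun w => (shifted R u n w / c) ^+ s)).
  rewrite -history_moment_phi /history_moment mulr_suml; congr (_%:E).
  by apply: eq_bigr => t _; rewrite expr_div_n mulrA.
apply: measurable_funX; apply: measurable_funM => //.
exact: measurable_shifted.
Qed.

End process.

(** * Diagonal coefficients as rational functions of time *)

Section roots.
Variables (R : realType) (u : urn).
Hypothesis (hm : (1 <= ssize u)%N) (hsigma : (1 <= sigma u)%N).
Hypothesis hT0 : (ssize u <= total_balls u 0)%N.
Hypothesis hLambda : 2^-1 < Lambda R u < 1.
Local Notation C := R[i].
Local Notation rc := (real_complex R).
Local Notation m := (ssize u).
Local Notation T := (total_balls u).

Let sC : (sigma u)%:R != 0 :> C.
Proof. by rewrite pnatr_eq0 -lt0n. Qed.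

Let TC n : (T n)%:R != 0 :> C.
Proof. by rewrite pnatr_eq0 -lt0n (leq_trans _ (total_balls_ge hsigma hT0 n))// addn_gt0 hm. Qed.

Let TnE n : (T n)%:R = (sigma u)%:R * n%:R + (T 0)%:R :> C.
Proof. by rewrite total_ballsE natrD natrM addrC. Qed.

Lemma prod_sub_ffact (F : nzRingType) x k : (k <= x)%N ->
  \prod_(i < k) (x%:R - i%:R) = (x ^_ k)%:R :> F.
Proof.
move=> kx; rewrite ffact_prod natr_prod; apply: eq_bigr => i _.
by rewrite natrB// ltnW// (leq_trans (ltn_ord i)).
Qed.

Lemma ffactD x k l : (x ^_ (k + l) = x ^_ k * (x - k) ^_ l)%N.
Proof.
elim: l => [|l IH]; first by rewrite addn0 ffactn0 muln1.
by rewrite addnS !ffactnSr IH mulnA subnDA.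
Qed.

Lemma fcoef_diag_complex n s : rc (fcoef R u n.+1 s s) =
  \sum_(0 <= j < s.+1) 'C(s, j)%:R * rc (Cst R u) ^+ j * rc (unit_moment R u n j).
Proof.
have term (k j : nat) (x y : R) : rc (k%:R * x ^+ j * y) = k%:R * rc x ^+ j * rc y.
  by rewrite 2!rmorphM rmorphXn rmorph_nat.
by rewrite fcoef_diag// rmorph_sum; apply: eq_bigr => j _; exact: term.
Qed.

(** Clearing the denominators 'C(T_n, j) of the diagonal coefficient by the largest
    of them leaves a polynomial in n. *)
Lemma fcoef_diag_Ppoly n s : model u = without_replacement ->
  rc (fcoef R u n.+1 s s) = (Ppoly R u s).[n%:R] /
    \prod_(l < minn s m) ((T 0 - l)%N%:R / (sigma u)%:R + n%:R).
Proof.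
move=> hM; set s' := minn s m.
have s'm : (s' <= m)%N by exact: geq_minr.
have s's : (s' <= s)%N by exact: geq_minl.
have s'T : (s' <= T n)%N.
  by rewrite (leq_trans s'm)// (leq_trans _ (total_balls_ge hsigma hT0 n))// leq_addr.
have tE : \prod_(l < s') ((T 0 - l)%N%:R / (sigma u)%:R + n%:R) =
    (T n ^_ s')%:R / (sigma u)%:R ^+ s' :> C.
  rewrite -prod_sub_ffact// -[in X in _ ^+ X](card_ord s') -prodr_const -prodf_div.
  apply: eq_bigr => l _; rewrite natrB; last first.
    by rewrite (leq_trans _ hT0)// (leq_trans _ s'm)// ltnW.
  by rewrite (TnE n); field.
have Tf k : (k <= T n)%N -> (T n ^_ k)%:R != 0 :> C by move=> kT; rewrite pnatr_eq0 -lt0n ffact_gt0.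
rewrite tE; apply: (canRL (mulfK _)).
  by rewrite mulf_neq0 ?invr_eq0 ?expf_neq0// Tf.
rewrite fcoef_diag_complex (big_cat_nat (n := s'.+1))//=.
rewrite [X in _ + X]big_nat [X in _ + X]big1 ?addr0; last first.
  move=> j /andP[s'j js]; rewrite unit_moment_small ?rmorph0 ?mulr0//.
  rewrite ltnNge; apply/negP => jm.
  by move: s'j; rewrite ltnNge /s' leq_min jm andbT -ltnS js.
rewrite /Ppoly -/s' hornerZ horner_sum mulr_suml mulr_sumr.
rewrite big_nat [RHS]big_nat; apply: eq_bigr => j /andP[_ js].
rewrite ltnS in js; rewrite hornerZ /binom_poly hornerZ horner_prod.
have -> : \prod_(i < s' - j) ((sigma u)%:R *: 'X + ((T 0)%:R - j%:R)%:P - i%:R%:P).[n%:R] =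
    ((T n - j) ^_ (s' - j))%:R :> C.
  rewrite -prod_sub_ffact ?leq_sub2r//; apply: eq_bigr => i _.
  rewrite !hornerD !hornerN hornerZ hornerX !hornerC natrB ?(leq_trans js)// (TnE n).
  by ring.
have umE : rc (unit_moment R u n j) = 'C(m, j)%:R / 'C(T n, j)%:R.
  by rewrite /unit_moment hM rmorphM fmorphV !rmorph_nat.
have h1 : (T n ^_ s')%:R = (T n ^_ j)%:R * ((T n - j) ^_ (s' - j))%:R :> C.
  by rewrite -natrM -ffactD subnKC.
have h2 : 'C(T n, j)%:R = (T n ^_ j)%:R / j`!%:R :> C.
  by rewrite -bin_ffact natrM mulfK// pnatr_eq0 -lt0n fact_gt0.
have h3 : 'C(s', j)%:R = s'`!%:R / (j`!%:R * (s' - j)`!%:R) :> C.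
  rewrite -(bin_fact js) natrM natrM mulfK// mulf_neq0// pnatr_eq0 -lt0n fact_gt0//.
have fne k : k`!%:R != 0 :> C by rewrite pnatr_eq0 -lt0n fact_gt0.
rewrite umE h1 h2 h3; field.
by rewrite !fne Tf ?(leq_trans js)// expf_neq0.
Qed.

Lemma fcoef_diag_Qpoly n s : model u = with_replacement ->
  rc (fcoef R u n.+1 s s) = (Qpoly R u s).[n%:R] /
    \prod_(l < s) ((T 0)%:R / (sigma u)%:R + n%:R).
Proof.
move=> hM.
have -> : \prod_(l < s) ((T 0)%:R / (sigma u)%:R + n%:R) = ((T n)%:R / (sigma u)%:R) ^+ s :> C.
  rewrite prodr_const card_ord (TnE n); congr (_ ^+ _); by field.
apply: (canRL (mulfK _)); first by rewrite expf_neq0// mulf_neq0 ?invr_eq0.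
rewrite fcoef_diag_complex /Qpoly hornerZ horner_sum mulr_suml mulr_sumr.
rewrite big_nat [RHS]big_nat; apply: eq_bigr => j /andP[_ js].
rewrite ltnS in js; rewrite hornerZ horner_exp hornerD hornerZ hornerX hornerC -(TnE n).
have umE : rc (unit_moment R u n j) = 'C(m, j)%:R * j`!%:R / (T n)%:R ^+ j.
  by rewrite /unit_moment hM rmorphM fmorphV rmorphXn !rmorph_nat -bin_ffact natrM.
rewrite umE expr_div_n -[in (T n)%:R ^+ s](subnK js) exprD; field.
by rewrite !expf_neq0.
Qed.

End roots.

(** * Identification of the limits *)

Section series.
Variables (R : realType) (u : urn).
Hypothesis f_neq0 : forall n p, fcoef R u n p p != 0.
Local Notation J := (jump R u).

Lemma tphi_chain_sum (g : R -> R) lo N l s h : (0 < lo)%N -> size h = l ->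
  chain_sum lo N l (fun i => g (tphi_term R u s h i 0)) =
  chain_sum lo N l (fun i => g (path_weight J s h i)).
Proof.
move=> lo0 sh; apply: eq_chain_sum => i si so ai _.
rewrite tphi_term_path// ?sh ?si//.
by apply: sub_all ai => z; exact: leq_trans.
Qed.

Lemma tphi0_chain_sum (g : R -> R) k N r s h l : size h = r ->
  s = (sumn h + l)%N ->
  chain_sum k.+1 N r (fun i => g (tphi_term R u s (rcons h l) i k)) =
  chain_sum k.+1 N r (fun i => g (path_weight J s h i * J k l 0)).
Proof.
move=> sh sE; apply: eq_chain_sum => i si so ai _.
by rewrite (tphi_term_path0 _ _ so ai sE)// sh si.
Qed.

Lemma tphi_posE s k : (1 <= k < s)%N -> tphi_pos R u s k = paths_lim J 1 s k.
Proof.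
move=> /andP[k1 ks]; rewrite /paths_lim big_nat_recl// comp_sum0 subn_eq0 leqNgt ks /=.
rewrite add0r /tphi_pos big_add1 /=; apply: eq_bigr => l _.
apply: eq_comp_sum => h /and3P[/eqP sh _ _]; rewrite /chain_series; congr (limn _).
by apply/funext => N; exact: (tphi_chain_sum id).
Qed.

Variable s : nat.
Hypothesis path_cvg : forall lo l h, (0 < lo)%N -> size h = l ->
  all (leq 1) h -> (sumn h <= s)%N -> chain_summable lo l (path_weight J s h).

Lemma tphi_pos_is_summable k : tphi_pos_summable R u s k.
Proof.
move=> l h _ /and3P[/eqP sh ah /eqP hE]; rewrite /chain_summable.
under eq_fun do rewrite (tphi_chain_sum (fun x => `|x|))//.
by apply: path_cvg => //; rewrite hE leq_subr.
Qed.

Lemma tphi0_is_summable k : (1 <= k)%N -> tphi0_summable R u s k.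
Proof.
move=> k1 l r h /andP[l1 ls] rs /and3P[/eqP sh ah /eqP hE]; rewrite /chain_summable.
have sE : s = (sumn h + l)%N by rewrite hE subnK.
under eq_fun do rewrite (tphi0_chain_sum (fun x => `|x|) _ _ sh sE).
rewrite (_ : (fun N => _) = (fun N => `|J k l 0| *
    chain_sum k.+1 N r (fun i => `|path_weight J s h i|))); last first.
  apply/funext => N; rewrite -chain_sumZ; apply: eq_chain_sum => i _ _ _ _.
  by rewrite normrM mulrC.
by apply: is_cvgMr; apply: path_cvg => //; rewrite hE leq_subr.
Qed.

Lemma tphi0E k : tphi0 R u s k =
  \sum_(1 <= l < s.+1) J k l 0 * paths_lim J k.+1 s l.
Proof.
rewrite /tphi0 big_nat [RHS]big_nat; apply: eq_bigr => l /andP[l1 ls].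
rewrite /paths_lim mulr_sumr; apply: eq_bigr => r _.
rewrite -comp_sumZ; apply: eq_comp_sum => h /and3P[/eqP sh ah /eqP hE].
have sE : s = (sumn h + l)%N by rewrite hE subnK.
rewrite {1}/chain_series.
under eq_fun do rewrite (tphi0_chain_sum id _ _ sh sE).
rewrite (_ : (fun N => _) = (fun N => J k l 0 * chain_sum k.+1 N r (path_weight J s h))).
  apply: cvg_lim => //; apply: cvgMr; apply: chain_summable_cvg.
  by apply: path_cvg => //; rewrite hE leq_subr.
by apply/funext => N; rewrite -chain_sumZ; apply: eq_chain_sum => i _ _ _ _; rewrite mulrC.
Qed.

End series.

Theorem theorem3 (R : realType) (u : urn)
    (hm : (1 <= ssize u)%N) (hsigma : (1 <= sigma u)%N)
    (hbal : balanced u) (haff : affine u) (hten : tenable u)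
    (hT0 : (ssize u <= total_balls u 0)%N)
    (ham : addw u (ssize u) != 0)
    (hLambda : 2^-1 < Lambda R u < 1)
    (d : measure_display) (Omega : measurableType d) (P : probability Omega R)
    (K : nat -> {RV P >-> nat}) (hK : urn_process u K)
    (s : nat) (hs : (1 <= s)%N) :
  let Wt (n : nat) (w : Omega) : R :=
    shifted R u n (white u (fun i => K i w) n) in
  let W0 : R := (white0 u)%:R in
  (forall n : nat,
     'E_P [fun w => (Wt n w ^+ s)%R]%E =
     (\sum_(0 <= k < s.+1) phi R u n s k * W0 ^+ k)%:E) /\
  exists (tphi : nat -> R) (E : R),
    [/\ (fun n : nat =>
           'E_P [fun w => ((Wt n w / n%:R `^ Lambda R u) ^+ s)%R]%E)
          @ \oo --> E%:E,
        match model u with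
        | without_replacement =>
            forall lam : 'I_(minn s (ssize u)) -> R[i],
              Ppoly R u s = \prod_(l < minn s (ssize u)) ('X + (lam l)%:P) ->
              real_complex R E =
              (\prod_(l < minn s (ssize u))
                 (Gamma ((total_balls u 0 - l)%N%:R / (sigma u)%:R) / Gamma (lam l)))
              * real_complex R (\sum_(0 <= k < s.+1) tphi k * W0 ^+ k)
        | with_replacement =>
            forall mu : 'I_s -> R[i],
              Qpoly R u s = \prod_(l < s) ('X + (mu l)%:P) ->
              real_complex R E =
              Gamma ((total_balls u 0)%:R / (sigma u)%:R) ^+ s
              / (\prod_(l < s) Gamma (mu l))
              * real_complex R (\sum_(0 <= k < s.+1) tphi k * W0 ^+ k)
        end,
        (forall k : nat, (1 <= k <= s)%N ->
           (fun n : nat => phi R u n s k / phi R u n s s) @ \oo --> tphi k)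
        /\ tphi s = 1,
        (forall k : nat, (1 <= k <= s.-1)%N ->
           tphi_pos_summable R u s k /\ tphi k = tphi_pos R u s k)
      & (forall k : nat, (1 <= k)%N -> tphi0_summable R u s k) /\
        (fun N : nat => \sum_(1 <= k < N.+1) tphi0 R u s k) @ \oo --> tphi 0%N].
Proof.
move=> Wt W0.
have f0 := fcoef_diag_neq0 hm hsigma hLambda.
have [beta [B [beta0 betaB hbeta]]] := jump_dominated hm hsigma hT0 hLambda s.
have [c c0 hc] := diag_prod_limit hm hsigma hT0 hLambda s.
have [L0 [seriesL0 cvgL0]] := paths0_cvg beta0 betaB hbeta.
have pcvg lo l h (lo0 : (0 < lo)%N) (sh : size h = l) (ah : all (leq 1) h) (hs' : (sumn h <= s)%N) :
    chain_summable lo l (path_weight (jump R u) s h).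
  by apply: (path_summable beta0 betaB hbeta).
have phiss n : phi R u n s s = diag_prod R u s n by rewrite /phi eqxx.
have ss0 n : phi R u n s s != 0 by rewrite phiss diag_prod_neq0.
pose tphi k := if k == 0%N then L0 else if k == s then 1 else tphi_pos R u s k.
have tphis : tphi s = 1 by rewrite /tphi eqxx gtn_eqF.
have ratio k : (k <= s)%N -> (fun n : nat => phi R u n s k / phi R u n s s) @ \oo --> tphi k.
  case: k => [_|k ks].
    rewrite (_ : (fun n => _) = (fun n => paths0 (jump R u) n s))//.
    by apply/funext => n; rewrite phi0_paths// phiss mulrC mulKf ?diag_prod_neq0.
  have [->|kns] := eqVneq k.+1 s.
    rewrite tphis (_ : (fun n => _) = (fun=> 1)); first exact: cvg_cst.
    by apply/funext => n; rewrite divff.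
  rewrite /tphi (negbTE kns) tphi_posE//=; last by rewrite ltn_neqAle kns ks.
  rewrite (_ : (fun n => _) = (fun n => paths (jump R u) 1 n s k.+1)).
    by apply: (paths_cvg beta0 betaB hbeta).
  by apply/funext => n; rewrite phi_paths// phiss mulrC mulKf ?diag_prod_neq0.
pose S := \sum_(0 <= k < s.+1) tphi k * W0 ^+ k.
have cvgE : (fun n : nat => (\sum_(0 <= k < s.+1) phi R u n s k * W0 ^+ k) /
    (n%:R `^ Lambda R u) ^+ s) @ \oo --> c * S.
  rewrite (_ : (fun n => _) = (fun n : nat => diag_prod R u s n / n%:R `^ (s%:R * Lambda R u) *
      \sum_(0 <= k < s.+1) phi R u n s k / phi R u n s s * W0 ^+ k)).
    apply: cvgM => //; apply: sum_nat_cvg => k /andP[_ ks].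
    by apply: cvgMl; exact: ratio.
  apply/funext => n.
  have -> : (n%:R `^ Lambda R u) ^+ s = n%:R `^ (s%:R * Lambda R u).
    by rewrite (mulrC s%:R) [RHS]powRrM powR_mulrn ?powR_ge0.
  rewrite [RHS]mulrAC; congr (_ / _); rewrite [RHS]mulr_sumr; apply: eq_bigr => k _.
  by rewrite mulrA phiss [_ * (_ / _)]mulrC divfK ?diag_prod_neq0.
split.
  by move=> n; exact: expectation_shifted_pow.
exists tphi, (c * S); split.
- rewrite (_ : (fun n => _) = (fun n => ((\sum_(0 <= k < s.+1) phi R u n s k * W0 ^+ k) /
    (n%:R `^ Lambda R u) ^+ s)%:E)).
    by apply: cvg_EFin => //; exact: nearW.
  by apply/funext => n; exact: expectation_normalized_pow.
- have limit k (t lam : 'I_k -> R[i]) : (forall l j, t l + j%:R != 0) ->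
      (forall n, real_complex R (fcoef R u n.+1 s s) =
        (\prod_(l < k) (lam l + n%:R)) / \prod_(l < k) (t l + n%:R)) ->
      real_complex R (c * S) = \prod_(l < k) (Gamma (t l) / Gamma (lam l)) * real_complex R S.
    move=> t0 fE; rewrite rmorphM; congr (_ * _).
    apply: (prod_rational_limit (f := fun j => fcoef R u j s s) t0 _ fE _ hc) => [n|].
      exact: f0.
    exact: fcoef_diag_asym.
  have tpos x j : (0 < x)%N -> x%:R / (sigma u)%:R + j%:R != 0 :> R[i].
    move=> x0; have s0 : (sigma u)%:R != 0 :> R[i] by rewrite pnatr_eq0 -lt0n.
    have -> : x%:R / (sigma u)%:R + j%:R = (x + j * sigma u)%:R / (sigma u)%:R :> R[i].
      by rewrite natrD natrM mulrDl mulfK.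
    by rewrite mulf_neq0 ?invr_eq0// pnatr_eq0 -lt0n addn_gt0 x0.
  have rootE k (lam : 'I_k -> R[i]) n :
      (\prod_(l < k) ('X + (lam l)%:P)).[n%:R] = \prod_(l < k) (lam l + n%:R).
    by rewrite horner_prod; apply: eq_bigr => l _; rewrite hornerD hornerX hornerC addrC.
  have wor := fcoef_diag_Ppoly R hm hsigma hT0.
  have wr := fcoef_diag_Qpoly R hm hsigma hT0.
  case: (model u) wor wr => wor wr.
    move=> lam PE; apply: limit.
      move=> l j; apply: tpos; rewrite subn_gt0.
      by apply: leq_trans hT0; apply: leq_trans (ltn_ord l) (geq_minr _ _).
    by move=> n; rewrite wor// PE rootE.
  move=> mu QE; rewrite -[X in _ ^+ X](card_ord s) -prodr_const -prodf_div.
  apply: limit; first by move=> l j; apply: tpos; apply: leq_trans hT0.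
  by move=> n; rewrite wr// QE rootE.
- by split=> // k /andP[_ ks]; exact: ratio.
- move=> k /andP[k1 ks]; split; first exact: tphi_pos_is_summable.
  have ks' : (k < s)%N by rewrite (leq_ltn_trans ks)// ltn_predL.
  by rewrite /tphi (gtn_eqF k1) (ltn_eqF ks').
- split; first exact: tphi0_is_summable.
  rewrite /tphi /= (_ : (fun N => _) = last_jump_series (jump R u) s)//.
  by apply/funext => N; apply: eq_bigr => k _; exact: tphi0E.
Qed.
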